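(* Let $\tau$ be selected uniformly from $\mathbb{S}^2_{(2,3,\infty)}$. For $r\ge 0$, the cumulative distribution $F(r)=\mathbf{Pr}\big(\{d_{\mathbb{S}^2_{(2,3,\infty)}}(\tau,i^* )<r\}\big)$ of the Teichmüller distance to the square lattice is given as follows. (1) If $0\le r\le\sinh^{-1}\big(\tfrac12\big)$, then $$F(r)=6\sinh^2\big(\tfrac r2\big).$$ (2) If $\sinh^{-1}\big(\tfrac12\big)\le r\le\sinh^{-1}\big(\tfrac1{\sqrt3}\big)$, then $$F(r)=6\sinh^2\big(\tfrac r2\big)-\frac6\pi\cosh(r)\tan^{-1}\left[\frac{4\cosh(r)\sqrt{2\cosh(2r)-3}}{7-3\cosh(2r)}\right]+\frac{12}{\pi}\tan^{-1}\left[\sqrt{2\cosh(2r)-3}\right].$$ (3) If $r\ge\sinh^{-1}\big(\tfrac1{\sqrt3}\big)$, then $$F(r)=1-\frac6\pi\tan^{-1}\left[\frac1{\sqrt{2\cosh(2r)-3}}\right]-\frac3\pi\cosh(r)\tan^{-1}\left[\frac{4\left(\cosh(2r)+\cosh(r)\sqrt{2\cosh(2r)-3}-1\right)}{5\cosh(2r)-2\cosh(4r)-8\sinh^2(r)\cosh(r)\sqrt{2\cosh(2r)-3}+1}\right].$$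
   Context: Let $\mathbb{H}^2=\{z\in\mathbb{C}:\Im z>0\}$ with the hyperbolic metric of curvature $-1$ (area form $|dz|^2/(\Im z)^2$), and let $\mathbb{S}^2_{(2,3,\infty)}=\mathbb{H}^2/PSL(2,\mathbb{Z})$ with the induced metric $d_{\mathbb{S}^2_{(2,3,\infty)}}$; it has hyperbolic area $\pi/3$ and is the moduli space of lattices $\Lambda_\tau=\{z\mapsto z+m+n\tau:m,n\in\mathbb Z\}$ of $\mathbb{C}$ (equivalently of punctured tori), the metric being the Teichmüller metric. ''Uniformly'' means with respect to normalised hyperbolic area; a fundamental domain is $\Omega=\{z:\Im z>0,\ |z|\ge1,\ -\frac12<\Re z\le\frac12\}$. The point $i^*$ is the projection of $i\in\mathbb{H}^2$, i.e. the cone point of order two, which corresponds to the square lattice. $\tan^{-1}$ is the principal branch, with values in $(-\pi/2,\pi/2)$. *)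

(* Defs.v *)
From HB Require Import structures.
From mathcomp Require Import all_boot all_order all_algebra.
From mathcomp Require Import generic_quotient.
From mathcomp Require Import all_classical all_reals all_analysis.
From mathcomp Require Import measurable_realfun complex.
From mathcomp Require Import ring lra.
Set Implicit Arguments.
Unset Strict Implicit.
Unset Printing Implicit Defensive.
Import Order.TTheory GRing.Theory Num.Theory.
Import numFieldNormedType.Exports Normc.
Local Open Scope classical_set_scope.
Local Open Scope ring_scope.
Local Open Scope quotient_scope.

Section hyperbolic_functions.
Context {R : realType}.
Implicit Types x : R.

Definition sinh x : R := (expR x - expR (- x)) / 2.
Definition cosh x : R := (expR x + expR (- x)) / 2.
Definition arsinh x : R := ln (x + Num.sqrt (x ^+ 2 + 1)).

Let arsinh_arg_gt0 x : 0 < x + Num.sqrt (x ^+ 2 + 1).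
Proof.
suff : `|x| < Num.sqrt (x ^+ 2 + 1) by rewrite ltr_norml => /andP[]; lra.
by rewrite -sqrtr_sqr ltr_sqrt ?ltrDl// ltr_wpDl ?sqr_ge0.
Qed.

Lemma arsinhK : cancel arsinh sinh.
Proof.
move=> x; rewrite /sinh expRN lnK ?posrE ?arsinh_arg_gt0//.
set s := Num.sqrt _; have x0 : x + s != 0 by rewrite gt_eqF ?arsinh_arg_gt0.
have s2 : s ^+ 2 = x ^+ 2 + 1 by rewrite sqr_sqrtr// addr_ge0 ?sqr_ge0.
suff -> : (x + s)^-1 = s - x by lra.
apply: (mulfI x0); rewrite mulfV//.
have -> : (x + s) * (s - x) = s ^+ 2 - x ^+ 2 by ring.
by rewrite s2; ring.
Qed.

Lemma sinhK : cancel sinh arsinh.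
Proof.
move=> x; rewrite /arsinh.
have -> : sinh x ^+ 2 + 1 = cosh x ^+ 2.
  rewrite /sinh /cosh expRN; field; by rewrite gt_eqF ?expR_gt0.
rewrite sqrtr_sqr ger0_norm; last by rewrite divr_ge0// addr_ge0 ?expR_ge0.
rewrite -[RHS]expRK; congr (ln _); rewrite /sinh /cosh; lra.
Qed.

End hyperbolic_functions.


Section upper_half_plane.
Context {R : realType}.

Record uhp := Uhp { uhpval :> R[i]; uhpP : 0 < complex.Im uhpval }.

HB.instance Definition _ := [isSub for uhpval].
HB.instance Definition _ := [Choice of uhp by <:].

Fact uhp_i_gt0 : 0 < complex.Im (Complex 0 1 : R[i]).
Proof. exact: ltr01. Qed.

Definition uhp_i : uhp := Uhp uhp_i_gt0.

HB.instance Definition _ := isPointed.Build uhp uhp_i.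

Definition uhp_coords (z : uhp) : R * R := (complex.Re z, complex.Im z).

(* Distance of the Riemannian metric |dz|^2 / (Im z)^2, of curvature -1:
   sinh (hdist z w / 2) = |z - w| / (2 sqrt (Im z Im w)). *)
Definition hdist (z w : uhp) : R :=
  2 * arsinh (normc (uhpval z - uhpval w)
              / (2 * Num.sqrt (complex.Im z * complex.Im w))).

Definition moebius (g : 'M[int]_2) (z : R[i]) : R[i] :=
  ((g 0 0)%:~R * z + (g 0 1)%:~R) / ((g 1 0)%:~R * z + (g 1 1)%:~R).

(* SL(2,Z) and its quotient PSL(2,Z) have the same orbits. *)
Definition psl2Z_rel (z w : uhp) : bool :=
  `[< exists2 g : 'M[int]_2, \det g = 1 & uhpval w = moebius g z >].

End upper_half_plane.
Arguments uhp : clear implicits.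

Section modular_equivalence.
Context {R : realType}.
Implicit Types (z w : uhp R) (g : 'M[int]_2).


Let det2 g : \det g = g 0 0 * g 1 1 - g 0 1 * g 1 0.
Proof.
rewrite (expand_det_row _ 0) !big_ord_recl big_ord0 addr0 /cofactor.
rewrite !det_mx11 !mxE /= expr0 expr1 mul1r mulN1r mulrN.
by congr (g _ _ * g _ _ - g _ _ * g _ _); exact/val_inj.
Qed.

Let detC g : \det g = 1 ->
  (g 0 0)%:~R * (g 1 1)%:~R - (g 0 1)%:~R * (g 1 0)%:~R = 1 :> R[i].
Proof. by rewrite det2 => h; rewrite -!intrM -intrB h. Qed.

Lemma moebius_denom_neq0 g z : \det g = 1 ->
  (g 1 0)%:~R * uhpval z + (g 1 1)%:~R != 0.
Proof.
move=> detg; apply/eqP => h0; have := detC detg.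
have iC (n : int) : n%:~R = Complex n%:~R 0 :> R[i].
  by rewrite -(rmorph_int (real_complex R)).
have [c0|c0] := eqVneq (g 1 0) 0.
  move: h0; rewrite c0 mul0r add0r => ->; rewrite !mulr0 subr0 => /eqP.
  by rewrite eq_sym oner_eq0.
move: h0 => + _; case: z => -[x y] /= y0; rewrite !iC; simpc => -[_ /eqP].
by rewrite mulf_eq0 intr_eq0 (negPf c0) (gt_eqF y0).
Qed.

Let psl2Z_refl : reflexive (@psl2Z_rel R).
Proof.
move=> z; apply/asboolP; exists 1%:M; first exact: det1.
by rewrite /moebius !mxE /= mul1r mul0r addr0 add0r divr1.
Qed.

Let mk2 (a b c d : int) : 'M[int]_2 :=
  \matrix_(i, j) if i == 0 then (if j == 0 then a else b)
                 else (if j == 0 then c else d).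

Let mk2E a b c d : (mk2 a b c d 0 0 = a) * (mk2 a b c d 0 1 = b)
  * (mk2 a b c d 1 0 = c) * (mk2 a b c d 1 1 = d).
Proof. by rewrite !mxE. Qed.

Let psl2Z_symW z w : psl2Z_rel z w -> psl2Z_rel w z.
Proof.
move=> /asboolP[g detg wE]; apply/asboolP.
have detg' : \det (mk2 (g 1 1) (- g 0 1) (- g 1 0) (g 0 0)) = 1.
  by rewrite det2 !mk2E -detg det2; ring.
exists (mk2 (g 1 1) (- g 0 1) (- g 1 0) (g 0 0)) => //.
have := moebius_denom_neq0 w detg'; have := moebius_denom_neq0 z detg.
have := detC detg; rewrite /moebius !mk2E wE /moebius !intrN.
set a := (g 0 0)%:~R; set b := (g 0 1)%:~R; set c := (g 1 0)%:~R.
set d := (g 1 1)%:~R; move: (uhpval z) => x adbc h1 h2.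
apply: (mulIf h2); rewrite divfK//.
by field.
Qed.

Let psl2Z_sym : symmetric (@psl2Z_rel R).
Proof. by move=> z w; apply/idP/idP; exact: psl2Z_symW. Qed.

Let psl2Z_trans : transitive (@psl2Z_rel R).
Proof.
move=> w z v /asboolP[g detg wE] /asboolP[h deth vE]; apply/asboolP.
exists (h *m g); first by rewrite det_mulmx detg deth mulr1.
have := moebius_denom_neq0 w deth; have := moebius_denom_neq0 z detg.
rewrite vE {2}/moebius wE /moebius !mxE !big_ord_recl !big_ord0 /= !addr0.
have -> : lift ord0 ord0 = 1 :> 'I_2 by exact/val_inj.
rewrite !intrD !intrM.
set a := (g 0 0)%:~R; set b := (g 0 1)%:~R; set c := (g 1 0)%:~R.
set d := (g 1 1)%:~R; move: (uhpval z) => x h1 h2.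
set e := (h 1 0)%:~R in h2 *; set f := (h 1 1)%:~R in h2 *.
have h3 : (e * a + f * c) * x + (e * b + f * d) != 0.
  apply: contra_neq h2 => h0; apply: (mulIf h1); rewrite mul0r -h0.
  by field.
have h4 : e * (a * x + b) + f * (c * x + d) != 0.
  by apply: contra_neq h3 => h0; rewrite -h0; ring.
field; do ?[apply/andP; split] => //.
Qed.

Canonical psl2Z_equiv :=
  EquivRel (@psl2Z_rel R) psl2Z_refl psl2Z_sym psl2Z_trans.

End modular_equivalence.

Section hyperbolic_area.
Context {R : realType}.
Local Open Scope ereal_scope.

HB.instance Definition _ :=
  Measurable.copy (uhp R) (g_sigma_algebra_preimageType (@uhp_coords R)).

Lemma measurable_uhp_coords :
  measurable_fun [set: uhp R] (@uhp_coords R).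
Proof. by move=> _ B mB; exists B. Qed.

Lemma uhp_coords_inj : injective (@uhp_coords R).
Proof. by move=> [[a b] ?] [[c d] ?] [ac bd]; apply/val_inj; rewrite /= ac bd. Qed.

Lemma image_uhp_coords_preimage (B : set (R * R)) :
  @uhp_coords R @` (@uhp_coords R @^-1` B) = B `&` [set p | (0 < p.2)%R].
Proof.
apply/seteqP; split=> [_ [z Bz <-]|[x y] [Bxy /= y0]]; first by split=> //; exact: uhpP.
by exists (@Uhp R (Complex x y) y0).
Qed.

Let measurable_y_gt0 : measurable [set p : R * R | (0 < p.2)%R].
Proof.
rewrite -[X in measurable X]setTI.
rewrite (_ : [set p : R * R | (0 < p.2)%R] = snd @^-1` `]0%R, +oo[%classic).
  by apply: measurable_snd.
by apply/seteqP; split=> p /=; rewrite in_itv/= andbT.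
Qed.

Lemma measurable_image_uhp_coords (A : set (uhp R)) :
  measurable A -> measurable (@uhp_coords R @` A).
Proof.
move=> [B mB <-]; rewrite setTI image_uhp_coords_preimage.
exact: measurableI.
Qed.

(* The measure dx dy / y^2, transported from R * R to the half-plane. *)
Definition hyp_area (A : set (uhp R)) : \bar R :=
  \int[lebesgue_measure \x lebesgue_measure]_(p in @uhp_coords R @` A)
    (p.2 ^- 2)%:E.

Let hyp_area0 : hyp_area set0 = 0.
Proof. by rewrite /hyp_area image_set0 integral_set0. Qed.

Let hyp_area_ge0 A : 0 <= hyp_area A.
Proof. by apply: integral_ge0 => p _; rewrite lee_fin invr_ge0 sqr_ge0. Qed.

Let measurable_density (D : set (R * R)) : measurable D ->
  D `<=` [set p | (0 < p.2)%R] ->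
  measurable_fun D (fun p : R * R => (p.2 ^- 2)%:E).
Proof.
move=> mD D0; apply/measurable_EFinP.
apply: (@measurable_comp _ _ _ _ _ _ (`]0%R, +oo[%classic : set R)
  (fun y : R => (y ^- 2)%R) D (@snd R R)) => //.
- by move=> _ [p Dp <-] /=; have /= p0 := D0 _ Dp; rewrite in_itv/= andbT.
- apply: open_continuous_measurable_fun; first exact: interval_open.
  move=> y; rewrite inE/= in_itv/= andbT => y0.
  by apply: cvgV; [rewrite expf_neq0// gt_eqF|exact: exprn_continuous].
- by apply: measurable_funTS; exact: measurable_snd.
Qed.

Let hyp_area_sigma_additive : semi_sigma_additive hyp_area.
Proof.
move=> F mF tF mUF; rewrite /hyp_area image_bigcup.
apply: cvg_toP.
  by apply: is_cvg_nneseries => n _ _; exact: hyp_area_ge0.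
rewrite ge0_integral_bigcup//.
- by move=> k; exact: measurable_image_uhp_coords.
- rewrite -image_bigcup; apply: measurable_density.
    exact: measurable_image_uhp_coords.
  by move=> _ [z _ <-]; exact: uhpP.
- by move=> p _; rewrite lee_fin invr_ge0 sqr_ge0.
- apply/trivIsetP => i j _ _ ij; apply/seteqP; split=> // _ [[z Fz <-] [w Fw]].
  move=> /uhp_coords_inj wz; rewrite wz in Fw.
  have : (F i `&` F j) z by [].
  by move/trivIsetP : tF => /(_ i j Logic.I Logic.I ij) ->.
Qed.

HB.instance Definition _ := isMeasure.Build _ _ _ hyp_area
  hyp_area0 hyp_area_ge0 hyp_area_sigma_additive.

Definition fundamental_domain : set (uhp R) :=
  [set z | (1 <= normc (uhpval z))%R /\
           (- (1 / 2) < complex.Re z <= 1 / 2)%R].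

Lemma measurable_fundamental_domain : measurable fundamental_domain.
Proof.
exists [set p : R * R | (1 <= Num.sqrt (p.1 ^+ 2 + p.2 ^+ 2))%R /\
           (- (1 / 2) < p.1 <= 1 / 2)%R]; last first.
  by rewrite setTI; apply/seteqP; split=> -[[x y] y0].
rewrite (_ : [set p | _] = [set p : R * R | 1 <= Num.sqrt (p.1 ^+ 2 + p.2 ^+ 2)]%R
    `&` (fst @^-1` `](- (1 / 2))%R, (1 / 2)%R]%classic)); last first.
  by apply/seteqP; split=> p /=; rewrite in_itv.
apply: measurableI; last first.
  by rewrite -[X in measurable X]setTI; exact: measurable_fst.
rewrite -[X in measurable X]setTI; apply: measurable_fun_le => //.
apply: (@measurableT_comp _ _ _ _ _ _ (@Num.sqrt R)).
  by apply: continuous_measurable_fun; exact: sqrt_continuous.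
apply: measurable_funD; apply: measurable_funX;
  [exact: measurable_fst|exact: measurable_snd].
Qed.

End hyperbolic_area.

Section moduli_space.
Context (R : realType).

(* The modular orbifold H^2 / PSL(2,Z) of signature (2,3,oo). *)
Definition moduli : Type := {eq_quot @psl2Z_equiv R}.

HB.instance Definition _ := Choice.on moduli.
HB.instance Definition _ := EqQuotient.on moduli.
HB.instance Definition _ := isPointed.Build moduli (\pi_moduli (@uhp_i R)).

Definition i_star : moduli := \pi_moduli (@uhp_i R).

Definition moduli_display : measure_display.
Proof. exact. Qed.

(* The quotient (final) sigma-algebra. *)
Definition moduli_measurable : set (set moduli) :=
  [set B | measurable (\pi_moduli @^-1` B : set (uhp R))].

Let moduli_measurable0 : moduli_measurable set0.
Proof. by rewrite /moduli_measurable /= preimage_set0. Qed.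

Let moduli_measurableC B : moduli_measurable B -> moduli_measurable (~` B).
Proof. by rewrite /moduli_measurable /= preimage_setC; exact: measurableC. Qed.

Let moduli_measurable_bigcup (F : (set moduli)^nat) :
  (forall i, moduli_measurable (F i)) -> moduli_measurable (\bigcup_i F i).
Proof.
move=> mF; rewrite /moduli_measurable /= preimage_bigcup.
by apply: bigcup_measurable => k _; exact: mF.
Qed.

HB.instance Definition _ := isMeasurable.Build moduli_display moduli
  moduli_measurable0 moduli_measurableC moduli_measurable_bigcup.

Lemma measurable_moduli_pi : measurable_fun [set: uhp R] \pi_moduli.
Proof. by move=> _ B mB; rewrite setTI. Qed.

(* Quotient metric: the infimum of the distances between the two orbits. *)
Definition moduli_dist (a b : moduli) : R :=
  inf [set hdist z w | z in [set z | \pi_moduli z = a]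
                     & w in [set w | \pi_moduli w = b]].

(* Hyperbolic area of the part of the fundamental domain lying over a set. *)
Definition moduli_area : set moduli -> \bar R :=
  pushforward (mrestr (@hyp_area R) (@measurable_fundamental_domain R))
    (\pi_moduli : uhp R -> moduli).

Let moduli_area0 : moduli_area set0 = 0%E.
Proof. by rewrite /moduli_area /pushforward preimage_set0 measure0. Qed.

Let moduli_area_ge0 B : (0 <= moduli_area B)%E.
Proof. by rewrite /moduli_area /pushforward measure_ge0. Qed.

Let moduli_area_sigma_additive : semi_sigma_additive moduli_area.
Proof.
move=> F mF tF mUF; rewrite /moduli_area /pushforward preimage_bigcup.
apply: measure_semi_sigma_additive => //.
apply/trivIsetP => i j _ _ ij; rewrite -preimage_setI.
by move/trivIsetP : tF => /(_ i j Logic.I Logic.I ij) ->; rewrite preimage_set0.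
Qed.

HB.instance Definition _ := isMeasure.Build _ _ _ moduli_area
  moduli_area0 moduli_area_ge0 moduli_area_sigma_additive.

(* moduli_area divided by its total mass; mnormalize only uses its second
   argument when the total mass is 0 or +oo, whereas here it is pi / 3. *)
Definition moduli_uniform : probability moduli R :=
  mnormalize moduli_area (dirac i_star).

End moduli_space.

(* Main.v *)
(* The lattice of tau in the domain Omega has the reduced basis (1, tau), so for
   every g in SL(2, Z) the sum |a tau + b|^2 + |c tau + d|^2 is at least
   |tau|^2 + 1.  Since cosh d(z, i) = (|z|^2 + 1) / (2 Im z), the point of the
   orbit of i closest to tau is i itself, and F(r) is 3 / pi times the area of
   the part of the disc x^2 + y^2 + 1 < 2 y cosh r lying in Omega.  The fibre of
   that part over x is bounded above by the disc, and below by the unit circle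
   if |x| <= tanh r, by the disc again if tanh r <= |x| <= sinh r.  Integrating
   dy / y^2 along the fibres leaves functions of x with arctangent primitives.
   The three cases are sinh r <= 1/2, tanh r <= 1/2 <= sinh r and
   1/2 <= tanh r. *)
Require Import Defs.
From mathcomp Require Import all_boot all_order all_algebra.
From mathcomp Require Import generic_quotient.
From mathcomp Require Import all_classical all_reals all_analysis.
From mathcomp Require Import complex measurable_realfun.
From mathcomp Require Import ring lra zify.
Set Implicit Arguments.
Unset Strict Implicit.
Unset Printing Implicit Defensive.
Import Order.TTheory GRing.Theory Num.Theory Normc.
Import numFieldNormedType.Exports.
Local Open Scope classical_set_scope.
Local Open Scope ring_scope.
Local Open Scope quotient_scope.

(** Let q(x) = sqrt (sinh r ^ 2 - x ^ 2), half the length of the vertical chord of the disc over x.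
    Its vanishing at |x| = sinh r decides the shape of the primitives. Over |x| <= tanh r the
    arctangents have arguments k x / q, smooth also at x = 0. Over the outer strips they have the
    reciprocals q / (k x), which stay continuous where q = 0, and whose pole at 0 lies outside those
    strips. At |x| = tanh r all arguments are rational in sinh r and cosh r, and by atan (1 / u) =
    pi / 2 - atan u the values there cancel up to pi (cosh r - 1). This is the origin of 6 sinh (r /
    2) ^ 2. The outer primitive vanishes at sinh r; in the second case its value at 1/2 subtracts
    the two segments of the disc beyond |x| = 1/2. The closed forms merge two arctangents into one,
    which is legitimate only while the sum stays in (-pi / 2, pi / 2). The inequalities on s = sqrt
    (2 cosh (2 r) - 3) = 2 q(1/2) serve to check this. *)

Section hyperbolic_functions.
Context {R : realType}.
Implicit Types x y : R.

Lemma sqr_cosh x : cosh x ^+ 2 = sinh x ^+ 2 + 1.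
Proof.
by rewrite /sinh /cosh expRN; field; rewrite gt_eqF ?expR_gt0.
Qed.

Lemma cosh_double x : cosh (2 * x) = 2 * sinh x ^+ 2 + 1.
Proof.
rewrite /sinh /cosh !expRN (_ : 2 * x = x + x) ?expRD; last by ring.
by field; rewrite gt_eqF ?expR_gt0.
Qed.

Lemma sinh_mono : {mono @sinh R : x y / x <= y}.
Proof.
apply: le_mono => x y xy; rewrite /sinh ltr_pM2r ?invr_gt0//.
by rewrite ltrB ?ltr_expR// ltrN2.
Qed.

Lemma sinh0 : sinh 0 = 0 :> R.
Proof. by rewrite /sinh oppr0 subrr mul0r. Qed.

Lemma cosh_gt0 x : 0 < cosh x.
Proof. by rewrite divr_gt0// addr_gt0 ?expR_gt0. Qed.

Lemma cosh_ge1 x : 1 <= cosh x.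
Proof.
rewrite -(@ler_pXn2r _ 2) ?nnegrE ?ler01 ?(ltW (cosh_gt0 _))//.
by rewrite sqr_cosh expr1n lerDr sqr_ge0.
Qed.

Lemma cosh_half x : cosh x = 2 * sinh (x / 2) ^+ 2 + 1.
Proof. by rewrite -cosh_double; congr cosh; field. Qed.

Lemma arsinh_lt x y : (arsinh x < y) = (x < sinh y).
Proof. by rewrite -(leW_mono sinh_mono) arsinhK. Qed.

Lemma arsinh_le x y : (arsinh x <= y) = (x <= sinh y).
Proof. by rewrite -sinh_mono arsinhK. Qed.

Lemma le_arsinh x y : (x <= arsinh y) = (sinh x <= y).
Proof. by rewrite -sinh_mono arsinhK. Qed.

Lemma arsinh_ge0 x : 0 <= x -> 0 <= arsinh x.
Proof. by rewrite le_arsinh sinh0. Qed.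

End hyperbolic_functions.

(** * Distance to the orbit of i *)

Section modular_action.
Context {R : realType}.
Implicit Types (z w : uhp R) (g : 'M[int]_2).

Lemma sqr_normc (z : R[i]) :
  normc z ^+ 2 = complex.Re z ^+ 2 + complex.Im z ^+ 2.
Proof. by case: z => x y /=; rewrite sqr_sqrtr// addr_ge0 ?sqr_ge0. Qed.

Lemma normc_ge0 (z : R[i]) : 0 <= normc z.
Proof. by case: z => x y /=; exact: sqrtr_ge0. Qed.

Lemma intr_Complex (n : int) : n%:~R = Complex n%:~R 0 :> R[i].
Proof. by rewrite -(rmorph_int (real_complex R)). Qed.

Lemma hdist_ge0 z w : 0 <= hdist z w.
Proof.
by rewrite mulr_ge0// arsinh_ge0// divr_ge0 ?normc_ge0.
Qed.

(** Squaring sinh (d / 2) < sinh (r / 2) and using cosh r - 1 = 2 sinh (r / 2) ^ 2 removes both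
    [arsinh] and the square root. *)
Lemma hdist_lt z w (r : R) : 0 <= r ->
  (hdist z w < r) = (normc (uhpval z - uhpval w) ^+ 2
                     < 2 * complex.Im z * complex.Im w * (cosh r - 1)).
Proof.
move=> r0; have p0 : 0 < complex.Im z * complex.Im w.
  by rewrite mulr_gt0 ?uhpP.
rewrite /hdist mulrC -ltr_pdivlMr// arsinh_lt (cosh_half r).
have : 0 <= sinh (r / 2) by rewrite -sinh0 sinh_mono divr_ge0.
move: (sinh _) => s s0.
rewrite ltr_pdivrMr ?mulr_gt0 ?sqrtr_gt0// -[LHS](@ltr_pXn2r _ 2)//; first last.
- by rewrite nnegrE; rewrite !mulr_ge0 ?sqrtr_ge0.
- by rewrite nnegrE normc_ge0.
rewrite !exprMn sqr_sqrtr ?(ltW p0)//.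
by congr (_ < _); ring.
Qed.

Lemma det_intr (A : pzRingType) g : \det g = 1 ->
  (g 0 0)%:~R * (g 1 1)%:~R - (g 0 1)%:~R * (g 1 0)%:~R = 1 :> A.
Proof.
move=> detg; rewrite -!intrM -intrB -[RHS]/(1%:~R) -detg; congr (_%:~R).
rewrite (expand_det_row _ 0) !big_ord_recl big_ord0 addr0 /cofactor.
rewrite !det_mx11 !mxE /= expr0 expr1 mul1r mulN1r mulrN.
by congr (g _ _ * g _ _ - g _ _ * g _ _); exact/val_inj.
Qed.

Lemma moebiusE g z : \det g = 1 ->
  let n := normc ((g 1 0)%:~R * uhpval z + (g 1 1)%:~R) ^+ 2 in
  0 < n /\ complex.Im (moebius g z) = complex.Im z / n.
Proof.
move=> detg /=; have /eqP d0 := moebius_denom_neq0 z detg.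
have ngt0 : 0 < normc ((g 1 0)%:~R * uhpval z + (g 1 1)%:~R).
  by rewrite lt_neqAle normc_ge0 andbT eq_sym; apply/eqP => /eq0_normc.
split; first by rewrite exprn_gt0.
have := det_intr R detg.
move: (exprn_gt0 2 ngt0).
rewrite sqr_normc /moebius !intr_Complex.
set c := (g 1 0)%:~R; set d := (g 1 1)%:~R.
set a := (g 0 0)%:~R; set b := (g 0 1)%:~R.
case: z {d0 ngt0} => -[x y] /= y0; simpc => /= n0 adbc.
transitivity (y * (a * d - b * c) / ((c * x + d) ^+ 2 + (c * y) ^+ 2)).
  by field; rewrite gt_eqF.
by rewrite adbc mulr1.
Qed.

(** For determinant 1, g z - g w = (z - w) / ((c z + d) (c w + d)), and the moduli of these
    denominators cancel against Im (g z) = Im z / |c z + d| ^ 2. *)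
Lemma hdist_moebius g z z' w w' : \det g = 1 ->
  uhpval z' = moebius g z -> uhpval w' = moebius g w ->
  hdist z' w' = hdist z w.
Proof.
move=> detg zE wE.
have [+ ] := moebiusE z detg; have [+ ] := moebiusE w detg.
rewrite -zE -wE.
have dz := moebius_denom_neq0 z detg; have dw := moebius_denom_neq0 w detg.
set nw := normc _; set nz := normc _ => nw0 wI nz0 zI.
have adbc := det_intr R[i] detg.
have dzw : uhpval z' - uhpval w' = (uhpval z - uhpval w) /
   ((g 1 0)%:~R * uhpval z + (g 1 1)%:~R) /
   ((g 1 0)%:~R * uhpval w + (g 1 1)%:~R).
  rewrite zE wE /moebius; move: adbc dz dw.
  set a := (g 0 0)%:~R; set b := (g 0 1)%:~R.
  set c := (g 1 0)%:~R; set d := (g 1 1)%:~R.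
  move: (uhpval z) (uhpval w) => x y adbc dz dw.
  transitivity ((a * d - b * c) * (x - y) / (c * x + d) / (c * y + d)).
    by field; rewrite dz dw.
  by rewrite adbc mul1r.
have {}nz0 : 0 < nz by rewrite lt_neqAle normc_ge0 andbT eq_sym -sqrf_eq0 gt_eqF.
have {}nw0 : 0 < nw by rewrite lt_neqAle normc_ge0 andbT eq_sym -sqrf_eq0 gt_eqF.
rewrite /hdist dzw !normcM !normcV -/nz -/nw zI wI.
have -> : complex.Im z / nz ^+ 2 * (complex.Im w / nw ^+ 2)
    = complex.Im z * complex.Im w * (nz * nw)^-1 ^+ 2.
  by field; rewrite !gt_eqF.
rewrite sqrtrM ?mulr_ge0 ?(ltW (uhpP _))// sqrtr_sqr ger0_norm; last first.
  by rewrite invr_ge0 mulr_ge0// ltW.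
congr (2 * arsinh _); field.
by rewrite sqrtr_eq0 -ltNge mulr_gt0 ?uhpP// !gt_eqF.
Qed.

Definition lattice_sqnorm (m n : int) (z : uhp R) : R :=
  normc (m%:~R * uhpval z + n%:~R) ^+ 2.

Lemma lattice_sqnormE m n z : lattice_sqnorm m n z =
  (m%:~R * complex.Re z + n%:~R) ^+ 2 + (m%:~R * complex.Im z) ^+ 2.
Proof.
by rewrite /lattice_sqnorm sqr_normc !intr_Complex; case: z => -[x y] y0 /=; simpc.
Qed.

(** Substituting |w| = |a z + b| / |c z + d| and Im w = Im z / |c z + d| ^ 2 in cosh d(w, i) = (|w|
    ^ 2 + 1) / (2 Im w) leaves the squared norms of the two vectors of a basis of the lattice of
    z. *)
Lemma hdist_i_lt g z w (r : R) : \det g = 1 -> uhpval w = moebius g z ->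
  0 <= r ->
  (hdist w (@uhp_i R) < r) =
  (lattice_sqnorm (g 0 0) (g 0 1) z + lattice_sqnorm (g 1 0) (g 1 1) z
   < 2 * complex.Im z * cosh r).
Proof.
move=> detg wE r0; rewrite hdist_lt//.
have [+ ] := moebiusE z detg; rewrite -wE /lattice_sqnorm.
set n := normc _ ^+ 2 => n0 wI.
have nE : normc ((g 0 0)%:~R * uhpval z + (g 0 1)%:~R) ^+ 2
          = n * normc (uhpval w) ^+ 2.
  rewrite /n -exprMn -normcM wE /moebius [in RHS]mulrCA divff ?mulr1//.
  exact: moebius_denom_neq0.
have -> : normc (uhpval w - uhpval (@uhp_i R)) ^+ 2
         = normc (uhpval w) ^+ 2 + 1 - 2 * complex.Im w.
  by rewrite !sqr_normc; case: (w) => -[x y] y0 /=; simpc => /=; ring.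
rewrite nE -[LHS](ltr_pM2l n0) /= wI.
rewrite -subr_gt0 -[RHS]subr_gt0; congr (0 < _); field.
by rewrite gt_eqF.
Qed.

Lemma moduli_eq z w : \pi_(moduli R) z = \pi_(moduli R) w <-> psl2Z_rel z w.
Proof. by split => [/eqmodP|] h; [|apply/eqmodP]. Qed.

Lemma psl2Z_sym z w : psl2Z_rel z w = psl2Z_rel w z.
Proof. exact: (generic_quotient.equiv_sym psl2Z_equiv). Qed.

Lemma psl2Z_trans : transitive (@psl2Z_rel R).
Proof. exact: (@generic_quotient.equiv_trans _ (@psl2Z_equiv R)). Qed.

(** The action is isometric, so any pair of points of the two orbits can be moved until the second
    one is i, and the infimum runs over matrices only. The inequality being strict, it is witnessed
    by a single pair. *)
Lemma moduli_dist_lt z (r : R) : 0 <= r ->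
  moduli_dist (\pi_(moduli R) z) (i_star R) < r <->
  exists2 g : 'M[int]_2, \det g = 1 &
    lattice_sqnorm (g 0 0) (g 0 1) z + lattice_sqnorm (g 1 0) (g 1 1) z
   < 2 * complex.Im z * cosh r.
Proof.
move=> r0.
have moeb_uhp g v : \det g = 1 -> 0 < complex.Im (moebius g (uhpval v)) :> R.
  by move=> detg; have [n0 ->] := moebiusE v detg; rewrite divr_gt0// uhpP.
split.
- move=> /inf_lt => /(_ _)[|_ [v + [w + <-]]].
    exists (hdist z (@uhp_i R)); exists z => //; exists (@uhp_i R) => //.
  rewrite /i_star => /moduli_eq zv /moduli_eq /asboolP[h deth iE].
  pose v' := Uhp (moeb_uhp h v deth).
  rewrite -(hdist_moebius (z' := v') deth erefl iE).
  have : psl2Z_rel z v'.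
    by apply: (@psl2Z_trans v); [rewrite psl2Z_sym|apply/asboolP; exists h].
  move=> /asboolP[g detg v'E].
  by rewrite (hdist_i_lt detg v'E r0) => ?; exists g.
- move=> [g detg]; pose v := Uhp (moeb_uhp g z detg).
  rewrite -(@hdist_i_lt g z v r detg erefl r0); apply: le_lt_trans.
  apply: ge_inf; first by exists 0 => _ [? _ [? _ <-]]; exact: hdist_ge0.
  exists v; last by exists (@uhp_i R).
  by apply/moduli_eq; rewrite psl2Z_sym; apply/asboolP; exists g.
Qed.

(** In |m z + n| ^ 2 = m ^ 2 |z| ^ 2 + 2 m n x + n ^ 2 the middle term is at least - |m n| because
    |x| <= 1/2. As |z| >= 1, the case m <> 0 reduces to m ^ 2 - |m n| + n ^ 2 >= 1, true for a
    positive definite form with integer values. *)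
Lemma lattice_sqnorm_ge (m n : int) z : fundamental_domain z ->
  (m, n) != (0, 0) ->
  (if m == 0 then 1 else normc (uhpval z) ^+ 2) <= lattice_sqnorm m n z.
Proof.
move=> [z1 /andP[x1 x2]] mn0.
have z21 : 1 <= normc (uhpval z) ^+ 2 by rewrite expr_ge1// normc_ge0.
rewrite lattice_sqnormE; move: z1 x1 x2 z21; rewrite sqr_normc.
set x := complex.Re z; set y := complex.Im z => _ x1 x2 z21.
have -> : (m%:~R * x + n%:~R) ^+ 2 + (m%:~R * y) ^+ 2 =
  m%:~R ^+ 2 * (x ^+ 2 + y ^+ 2) + 2 * (m * n)%:~R * x + n%:~R ^+ 2.
  by rewrite intrM; ring.
have mnx : - `|m * n|%:~R <= 2 * (m * n)%:~R * x.
  have [p0|p0] := leP 0 (m * n).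
    rewrite ger0_norm//; have := p0; rewrite -(ler0z R); nra.
  rewrite ltr0_norm// intrN opprK; have := p0; rewrite -(ltrz0 R); nra.
have [m0|m0] := eqVneq m 0.
  have n0 : n != 0 by apply: contraNneq mn0 => ->; rewrite m0.
  rewrite m0 !mul0r mulr0 expr0n /= !mul0r !add0r -(rmorphXn (intmul (1 : R))).
  rewrite -[X in X <= _]/(1%:~R) ler_int.
  nia.
have m2 : 1 <= m ^+ 2 by nia.
have h : 0 <= m ^+ 2 - 1 - `|m * n| + n ^+ 2.
  have [p0|p0] := leP 0 (m * n); nia.
have := h; rewrite -(ler0z R) !rmorphD !rmorphN /= !rmorphXn /= => h'.
have := m2; rewrite -(ler_int R) rmorphXn /=.
nra.
Qed.

Lemma moduli_dist_lt_fundamental z (r : R) : 0 <= r -> fundamental_domain z ->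
  moduli_dist (\pi_(moduli R) z) (i_star R) < r <->
  normc (uhpval z) ^+ 2 + 1 < 2 * complex.Im z * cosh r.
Proof.
move=> r0 fz; rewrite moduli_dist_lt//; split.
- move=> [g detg]; apply: le_lt_trans.
  have := det_intr int detg; rewrite !intz => adbc.
  have z21 : 1 <= normc (uhpval z) ^+ 2.
    by case: fz => ? _; rewrite expr_ge1// normc_ge0.
  have ab0 : (g 0 0, g 0 1) != (0, 0).
    by apply/eqP => -[a0 b0]; move: adbc; rewrite a0 b0 !mul0r.
  have cd0 : (g 1 0, g 1 1) != (0, 0).
    by apply/eqP => -[c0 d0]; move: adbc; rewrite c0 d0 !mulr0.
  have := lattice_sqnorm_ge fz ab0; have := lattice_sqnorm_ge fz cd0.
  (* If a and c are both nonzero, the sum is at least 2 |z| ^ 2 >= |z| ^ 2 + 1; both zero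
     contradicts the determinant. *)
  case: eqP => [c0|_]; case: eqP => [a0|_] //; try lra.
  by move: adbc; rewrite a0 c0 mul0r mulr0.
- move=> h; exists 1%:M; first exact: det1.
  rewrite !lattice_sqnormE !mxE /=; move: h; rewrite sqr_normc.
  by rewrite !(mul0r, mul1r, add0r, addr0) expr1n expr0n addr0.
Qed.

End modular_action.

(** * Fibrewise integration of the hyperbolic area form *)

Section integration.
Context {R : realType}.
Notation mu := (@lebesgue_measure R).

Lemma continuous_within (f : R -> R) (A : set R) :
  (forall x, A x -> {for x, continuous f}) -> {within A, continuous f}.
Proof.
by move=> cf; apply: continuous_in_subspaceT => x /set_mem /cf.
Qed.

(** At an end |x| = sinh r the square root is continuous but not differentiable, so
    differentiability is asked only inside the interval. The booleans choose open or closed ends. *)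
Lemma integral_itv_FTC (b0 b1 : bool) (f F : R -> R) (a b : R) : a <= b ->
  (forall x, a <= x <= b -> {for x, continuous f}) ->
  (forall x, a <= x <= b -> {for x, continuous F}) ->
  (forall x, a < x < b -> is_derive x 1 F (f x)) ->
  (\int[mu]_(x in [set` Interval (BSide b0 a) (BSide b1 b)]) (f x)%:E
   = (F b - F a)%:E)%E.
Proof.
move=> ab cf cF dF; have cfab : {within `[a, b], continuous f}.
  by apply: continuous_within => x /=; rewrite in_itv/=; exact: cf.
have mf : measurable_fun `]a, b[ (EFin \o f).
  apply/measurable_EFinP; apply: (@measurable_funS _ _ _ _ `[a, b]) => //.
    exact: subset_itv_oo_cc.
  exact: subspace_continuous_measurable_fun.
rewrite (@integral_itv_bndoo _ _ _ (EFin \o f))//.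
move: ab; rewrite le_eqVlt => /predU1P[ab|ab].
  by rewrite ab subrr set_itvoo0// integral_set0.
rewrite -(@integral_itv_bndoo _ _ _ (EFin \o f) true false)//.
rewrite EFinB; apply: continuous_FTC2 => //.
- split.
  + by move=> x /[!in_itv]/= /dF [].
  + by apply: cvg_at_right_filter; apply: cF; rewrite lexx ltW.
  + by apply: cvg_at_left_filter; apply: cF; rewrite lexx ltW.
- by move=> x /[!in_itv]/= /dF [_ <-]; rewrite derive1E.
Qed.

Lemma is_derive_inv (x : R) : x != 0 -> is_derive x 1 (fun y => - y^-1) (x ^- 2).
Proof.
move=> x0; apply: is_derive_eq; first by apply: is_deriveN; apply: is_deriveV.
by rewrite /GRing.scale/= mulr1 opprK.
Qed.

(** The unit circle belongs to the domain and the boundary of the disc does not, so some fibres are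
    half-open and others open; the two inclusions treat them together. *)
Lemma integral_hyp_fiber (A : set R) (a b : R) : 0 < a -> a <= b ->
  measurable A -> `]a, b[ `<=` A -> A `<=` `[a, b] ->
  (\int[mu]_(y in A) (y ^- 2)%:E = (a^-1 - b^-1)%:E)%E.
Proof.
move=> a0 ab mA abA Aab.
have ftc b0 b1 : (\int[mu]_(y in [set` Interval (BSide b0 a) (BSide b1 b)])
    (y ^- 2)%:E = (a^-1 - b^-1)%:E)%E.
  rewrite -[a^-1]opprK addrC.
  apply: (@integral_itv_FTC _ _ _ (fun y => - y^-1)) => //.
  - move=> x /andP[ax _]; apply: continuousV; last exact: exprn_continuous.
    by rewrite expf_neq0// gt_eqF// (lt_le_trans a0).
  - move=> x /andP[ax _]; apply: continuousN; apply: continuousV => //.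
    by rewrite gt_eqF// (lt_le_trans a0).
  - move=> x /andP[ax _]; apply: is_derive_inv.
    by rewrite gt_eqF// (lt_trans a0).
have p0 (y : R) : (0 <= (y ^- 2)%:E)%E by rewrite lee_fin invr_ge0 sqr_ge0.
have mf : measurable_fun `[a, b] (fun y : R => (y ^- 2)%:E).
  apply/measurable_EFinP; apply: subspace_continuous_measurable_fun => //.
  apply: continuous_within => x /= /[!in_itv]/= /andP[ax _].
  apply: continuousV; last exact: exprn_continuous.
  by rewrite expf_neq0// gt_eqF// (lt_le_trans a0).
apply/eqP; rewrite eq_le; apply/andP; split.
- rewrite -(ftc true false); exact: ge0_subset_integral.
- rewrite -(ftc false true); apply: ge0_subset_integral => //.
  exact: measurable_funS mf.
Qed.

Lemma integral_hyp_fibery (a : R) : 0 < a ->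
  (\int[mu]_(y in `[a, +oo[) (y ^- 2)%:E = (a^-1)%:E)%E.
Proof.
move=> a0; rewrite (@ge0_continuous_FTC2y _ _ (fun y => - y^-1) _ 0)//.
- by rewrite sub0e -EFinN opprK.
- by move=> x _; rewrite invr_ge0 sqr_ge0.
- apply: continuous_within => x /= /[!in_itv]/= /andP[ax _].
  apply: continuousV; last exact: exprn_continuous.
  by rewrite expf_neq0// gt_eqF// (lt_le_trans a0).
- by rewrite -oppr0; apply: cvgN; apply/gtr0_cvgV0; [near=> x|apply: cvg_id].
- by move=> x ax; case: (@is_derive_inv x) => //; rewrite gt_eqF// (lt_trans a0).
- apply: cvg_at_right_filter; apply: continuousN; apply: continuousV => //.
  by rewrite gt_eqF.
- move=> x /= /[!in_itv]/= /andP[ax _].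
  by case: (@is_derive_inv x) => [|_ <-]; rewrite ?derive1E// gt_eqF// (lt_trans a0).
Unshelve. all: by end_near. Qed.

Lemma measurable_hyp_density (D : set (R * R)) : measurable D ->
  D `<=` [set p | 0 < p.2] ->
  measurable_fun D (fun p : R * R => (p.2 ^- 2)%:E).
Proof.
move=> mD D0; apply/measurable_EFinP.
apply: (@measurable_comp _ _ _ _ _ _ (`]0, +oo[%classic : set R)
  (fun y : R => y ^- 2) D (@snd R R)) => //.
- by move=> _ [p Dp <-] /=; have /= p0 := D0 _ Dp; rewrite in_itv/= andbT.
- apply: open_continuous_measurable_fun; first exact: interval_open.
  move=> y; rewrite inE/= in_itv/= andbT => y0.
  by apply: cvgV; [rewrite expf_neq0// gt_eqF|exact: exprn_continuous].
- by apply: measurable_funTS; exact: measurable_snd.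
Qed.

Lemma integral_hyp_fibration (D : set (R * R)) (E : set R) (h : R -> R) :
  measurable D -> D `<=` [set p | 0 < p.2] ->
  (forall x, E x ->
    (\int[mu]_(y in [set y | D (x, y)]) (y ^- 2)%:E = (h x)%:E)%E) ->
  (forall x, ~ E x -> [set y | D (x, y)] = set0) ->
  (\int[mu \x mu]_(p in D) (p.2 ^- 2)%:E = \int[mu]_(x in E) (h x)%:E)%E.
Proof.
move=> mD D0 hE hNE; rewrite integral_mkcond fubini_tonelli1; first last.
- move=> p; rewrite patchE; case: ifP => // _.
  by rewrite lee_fin invr_ge0 sqr_ge0.
- by apply/(measurable_restrictT _ mD); exact: measurable_hyp_density.
rewrite [RHS]integral_mkcond; apply: eq_integral => x _.
rewrite /fubini_F patchE.
transitivity (\int[mu]_(y in [set y | D (x, y)]) (y ^- 2)%:E)%E.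
  rewrite [RHS]integral_mkcond; apply: eq_integral => y _; rewrite !patchE.
  by congr (if _ then _ else _).
by case: ifPn => [/set_mem /hE//|/negP xE]; rewrite hNE ?integral_set0// => /mem_set.
Qed.

End integration.

(** * Arctangents *)

Section arctangent.
Context {R : realType}.
Implicit Types x y : R.

Lemma atan_ge0 x : 0 <= x -> 0 <= atan x.
Proof. by move=> x0; rewrite -atan0 le_atan. Qed.

Lemma cos_atan_neq0 x : cos (atan x) != 0.
Proof. by rewrite gt_eqF// cos_gt0_pihalf// atan_gtNpi2 atan_ltpi2. Qed.

Lemma atanD x y : - (pi / 2) < atan x + atan y < pi / 2 ->
  atan x + atan y = atan ((x + y) / (1 - x * y)).
Proof.
by move=> xy; rewrite -[LHS]tanK ?in_itv// tanD ?cos_atan_neq0// !atanK.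
Qed.

(** For nonnegative arguments the difference stays in (-pi / 2, pi / 2), so the tangent formula
    holds without a multiple of pi. *)
Lemma atanB x y : 0 <= x -> 0 <= y ->
  atan x - atan y = atan ((x - y) / (1 + x * y)).
Proof.
move=> x0 y0; rewrite -atanN atanD ?mulrN ?opprK// atanN.
by have := atan_ge0 x0; have := atan_ge0 y0; have := atan_ltpi2 x;
  have := atan_ltpi2 y; lra.
Qed.

Lemma atan_double x : -1 < x < 1 ->
  2 * atan x = atan (2 * x / (1 - x ^+ 2)).
Proof.
move=> /andP[x1 x2]; rewrite mulr_natl mulr2n atanD; last first.
  have := lt_atan x1; have := lt_atan x2; rewrite atanN atan1.
  by have := @pi_gt0 R; lra.
by congr (atan (_ / _)); ring.
Qed.

Lemma atanV x : 0 < x -> atan x^-1 = pi / 2 - atan x.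
Proof.
move=> x0; rewrite -[RHS]tanK ?in_itv/=; last first.
  by have := lt_atan x0; rewrite atan0; have := atan_ltpi2 x; lra.
congr atan; rewrite /tan sinB cosB sin_pihalf cos_pihalf !mul0r !mul1r subr0 add0r.
by rewrite -{1}(atanK x) /tan invf_div.
Qed.

(** With u = 1 / sqrt 3, doubling gives 2 atan u = atan (1 / u) = pi / 2 - atan u. The argument
    keeps the form x / sqrt (1 - x ^ 2) at x = 1/2, in which the primitives produce it. *)
Lemma atan_inv_sqrt3 : atan ((1 / 2) / Num.sqrt (1 - (1 / 2) ^+ 2)) = pi / 6 :> R.
Proof.
have -> : 1 - (1 / 2) ^+ 2 = 3 / 2 ^+ 2 :> R by field.
rewrite sqrtrM// sqrtrV// sqrtr_sqr ger0_norm//.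
have s3 : 0 < Num.sqrt 3 :> R by rewrite sqrtr_gt0.
have s32 : Num.sqrt 3 ^+ 2 = 3 :> R by rewrite sqr_sqrtr.
set s := Num.sqrt 3 in s3 s32 *.
have -> : 1 / 2 / (s / 2) = s^-1 by field; rewrite gt_eqF.
have h : 2 * atan s^-1 = atan s.
  rewrite atan_double.
    congr atan; have -> : 1 - s^-1 ^+ 2 = 2 / 3 by rewrite exprVn s32; field.
    by rewrite -s32; field; rewrite gt_eqF.
  rewrite (lt_trans _ (_ : 0 < _)) ?invr_gt0 ?ltrN10//= invf_lt1//.
  by rewrite -(@ltr_pXn2r _ 2) ?nnegrE ?ler01 ?(ltW s3)// s32 expr1n ltr1n.
by have := atanV s3; rewrite -h; lra.
Qed.

End arctangent.

(** * Derivatives of the arctangents that make up the primitives *)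

Section antiderivatives.
Context {R : realType}.
Variables (S2 k : R).
Hypotheses (k0 : 0 < k).
Implicit Types x : R.
Let q x := Num.sqrt (S2 - x ^+ 2).

Lemma continuous_sqrtB x : {for x, continuous (fun x : R => Num.sqrt (S2 - x ^+ 2))}.
Proof.
apply: continuous_comp; last exact: sqrt_continuous.
by apply: continuousB; [exact: cst_continuous|exact: exprn_continuous].
Qed.

Lemma is_derive_mull x : is_derive x 1 (fun x => k * x) k.
Proof.
have -> : (fun x : R => k * x) = k \*: (id : R -> R) by apply/funext.
by apply: is_derive_eq; rewrite /GRing.scale/= mulr1.
Qed.

Lemma is_derive_sqrtB x : x ^+ 2 < S2 -> is_derive x 1 q (- x / q x).
Proof.
move=> xS; have q0 : 0 < S2 - x ^+ 2 by rewrite subr_gt0.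
have d1 := is_derive1_sqrt q0.
have d2 : is_derive x 1 (fun x : R => S2 - x ^+ 2) (- (2 * x)).
  have -> : (fun x : R => S2 - x ^+ 2) = cst S2 - (id : R -> R) ^+ 2.
    by apply/funext.
  by apply: is_derive_eq; rewrite /GRing.scale/= mulr1 sub0r expr1.
apply: (is_derive_eq (is_derive1_comp (g := fun x : R => S2 - x ^+ 2) d1 d2)).
by rewrite /q; field; rewrite sqrtr_eq0 -ltNge q0.
Qed.

Lemma is_derive_atan_div x : x ^+ 2 < S2 ->
  is_derive x 1 (fun x => atan (k * x / q x))
    (k * S2 / (q x * (q x ^+ 2 + (k * x) ^+ 2))).
Proof.
move=> xS; have q0 : 0 < q x by rewrite sqrtr_gt0 subr_gt0.
have q2 : q x ^+ 2 = S2 - x ^+ 2 by rewrite sqr_sqrtr// subr_ge0 ltW.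
have dV := is_deriveV (lt0r_neq0 q0) (is_derive_sqrtB xS).
have dk := is_derive_mull x.
apply: (is_derive_eq (is_derive1_comp (g := fun x => k * x / q x)
    (is_derive1_atan _) (is_deriveM dk dV))).
rewrite /GRing.scale/=.
have d0 : q x ^+ 2 + (k * x) ^+ 2 != 0.
  by rewrite gt_eqF// ltr_wpDr ?sqr_ge0// exprn_gt0.
have -> : S2 = q x ^+ 2 + x ^+ 2 by rewrite q2; ring.
by field; rewrite d0 (gt_eqF q0).
Qed.

(** The argument is the reciprocal of the one in [is_derive_atan_div], so the two arctangents have a
    locally constant sum and opposite derivatives. *)
Lemma is_derive_atan_divV x : x != 0 -> x ^+ 2 < S2 ->
  is_derive x 1 (fun x => atan (q x / (k * x)))
    (- (k * S2 / (q x * (q x ^+ 2 + (k * x) ^+ 2)))).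
Proof.
move=> x0 xS; have q0 : 0 < q x by rewrite sqrtr_gt0 subr_gt0.
have q2 : q x ^+ 2 = S2 - x ^+ 2 by rewrite sqr_sqrtr// subr_ge0 ltW.
have dk := is_derive_mull x.
have kx0 : k * x != 0 by rewrite mulf_neq0// gt_eqF.
apply: (is_derive_eq (is_derive1_comp (g := fun x => q x / (k * x)) (is_derive1_atan _)
    (is_deriveM (is_derive_sqrtB xS) (is_deriveV kx0 dk)))).
rewrite /GRing.scale/=.
have d0 : q x ^+ 2 + (k * x) ^+ 2 != 0.
  by rewrite gt_eqF// ltr_wpDr ?sqr_ge0// exprn_gt0.
have -> : S2 = q x ^+ 2 + x ^+ 2 by rewrite q2; ring.
by field; rewrite !(gt_eqF k0) x0 d0 (gt_eqF q0).
Qed.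

End antiderivatives.

Lemma is_derive_continuous {R : realType} (f : R -> R) (x l : R) :
  is_derive x 1 f l -> {for x, continuous f}.
Proof.
by move=> [df _]; apply: differentiable_continuous; exact/derivable1_diffP.
Qed.

(** * Primitives of the fibre integrals *)

Section primitives.
Context {R : realType}.
Notation mu := (@lebesgue_measure R).
Variables (c S2 : R).
Hypotheses (c0 : 0 < c) (cS : c ^+ 2 = S2 + 1).
Implicit Types x : R.
Let q x := Num.sqrt (S2 - x ^+ 2).

Let sqr1_gt0 x : 0 < 1 + x ^+ 2.
Proof. by rewrite ltr_wpDr ?sqr_ge0. Qed.

Let q_gt0 x : x ^+ 2 < S2 -> 0 < q x.
Proof. by move=> xS; rewrite sqrtr_gt0 subr_gt0. Qed.

Let sqr_q x : x ^+ 2 <= S2 -> q x ^+ 2 = S2 - x ^+ 2.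
Proof. by move=> xS; rewrite sqr_sqrtr// subr_ge0. Qed.

(* With [c = cosh r] and [S2 = sinh r ^+ 2], the integral of [y ^- 2] over the
   fibre of the disc above [x], cut from below by the unit circle ([cap]) or
   not ([lens]). *)
Definition cap_density x :=
  (Num.sqrt (1 - x ^+ 2))^-1 - (c - q x) / (1 + x ^+ 2).

(** The first term is the arcsine of x. The last two integrate q / (1 + x ^ 2) = c ^ 2 / (q (1 + x ^
    2)) - 1 / q, an identity that follows from q ^ 2 = c ^ 2 - (1 + x ^ 2). The factors 1 match
    [is_derive_atan_div] at k = 1. *)
Definition cap_primitive x := atan (1 * x / Num.sqrt (1 - x ^+ 2))
  - c * atan x + c * atan (c * x / q x) - atan (1 * x / q x).

Definition lens_density x := 2 * q x / (1 + x ^+ 2).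

(** The same splitting of q / (1 + x ^ 2), with reciprocal arguments so that the function is
    continuous, and zero, where q = 0. *)
Definition lens_primitive x :=
  2 * (atan (q x / (1 * x)) - c * atan (q x / (c * x))).

Lemma cap_primitiveN x : cap_primitive (- x) = - cap_primitive x.
Proof. by rewrite /cap_primitive /q !sqrrN !mulrN !mulNr !atanN; ring. Qed.

Lemma lens_primitiveN x : lens_primitive (- x) = - lens_primitive x.
Proof. by rewrite /lens_primitive /q !sqrrN !mulrN !invrN !mulrN !atanN; ring. Qed.

Lemma is_derive_cap_primitive x : x ^+ 2 < S2 -> x ^+ 2 < 1 ->
  is_derive x 1 cap_primitive (cap_density x).
Proof.
move=> xS x1.
have d1 := is_derive_atan_div 1 x1.
have d2 := is_derive_atan_div c xS.
have d3 := is_derive_atan_div 1 xS.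
have d4 := is_derive1_atan x.
have d5 := is_deriveB (is_deriveD (is_deriveB d1 (is_deriveZ c d4))
  (is_deriveZ c d2)) d3.
apply: (is_derive_eq d5); rewrite /cap_density /GRing.scale/= -/(q x).
have q0 := q_gt0 xS; have q2 := sqr_q (ltW xS).
have r0 : 0 < Num.sqrt (1 - x ^+ 2) by rewrite sqrtr_gt0 subr_gt0.
have r2 : Num.sqrt (1 - x ^+ 2) ^+ 2 = 1 - x ^+ 2 by rewrite sqr_sqrtr// subr_ge0 ltW.
rewrite !mul1r r2 subrK q2 subrK exprMn cS.
have -> : S2 - x ^+ 2 + (S2 + 1) * x ^+ 2 = S2 * (1 + x ^+ 2) by ring.
have S0 : S2 != 0 by rewrite gt_eqF// (le_lt_trans _ xS) ?sqr_ge0.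
set r := Num.sqrt _ in r0 r2 *.
have -> : c * (c * S2 / (q x * (S2 * (1 + x ^+ 2)))) =
  c ^+ 2 / (q x * (1 + x ^+ 2)).
  by field; rewrite S0 !gt_eqF.
rewrite cS -[S2](subrK (x ^+ 2)) -q2.
by field; rewrite q2 subrK S0 !gt_eqF.
Qed.

Lemma is_derive_lens_primitive x : x != 0 -> x ^+ 2 < S2 ->
  is_derive x 1 lens_primitive (lens_density x).
Proof.
move=> x0 xS.
have d1 := @is_derive_atan_divV _ _ _ ltr01 _ x0 xS.
have d2 := @is_derive_atan_divV _ _ _ c0 _ x0 xS.
have d3 := is_deriveZ 2 (is_deriveB d1 (is_deriveZ c d2)).
apply: (is_derive_eq d3); rewrite /lens_density /GRing.scale/= -/(q x).
have q0 := q_gt0 xS; have q2 := sqr_q (ltW xS).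
rewrite !mul1r q2 subrK exprMn cS.
have -> : S2 - x ^+ 2 + (S2 + 1) * x ^+ 2 = S2 * (1 + x ^+ 2) by ring.
have S0 : S2 != 0 by rewrite gt_eqF// (le_lt_trans _ xS) ?sqr_ge0.
rewrite mulrN.
have -> : c * (c * S2 / (q x * (S2 * (1 + x ^+ 2)))) =
  c ^+ 2 / (q x * (1 + x ^+ 2)).
  by field; rewrite S0 !gt_eqF.
rewrite cS -[S2](subrK (x ^+ 2)) -q2.
by field; rewrite q2 subrK S0 !gt_eqF.
Qed.

Lemma continuous_cap_density x : x ^+ 2 < 1 -> {for x, continuous cap_density}.
Proof.
move=> x1; apply: continuousB.
  apply: continuousV; last exact: continuous_sqrtB.
  by rewrite gt_eqF// sqrtr_gt0 subr_gt0.
apply: continuousM.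
  by apply: continuousB; [exact: cst_continuous|exact: continuous_sqrtB].
apply: continuousV; first by rewrite gt_eqF.
by apply: continuousD; [exact: cst_continuous|exact: exprn_continuous].
Qed.

Lemma continuous_lens_density x : {for x, continuous lens_density}.
Proof.
apply: continuousM.
  by apply: continuousM; [exact: cst_continuous|exact: continuous_sqrtB].
apply: continuousV; first by rewrite gt_eqF.
by apply: continuousD; [exact: cst_continuous|exact: exprn_continuous].
Qed.

Lemma continuous_atan_sqrtB k x : k * x != 0 ->
  {for x, continuous (fun x => atan (q x / (k * x)))}.
Proof.
move=> kx; apply: continuous_comp; last exact: continuous_atan.
apply: continuousM; first exact: continuous_sqrtB.
apply: continuousV => //; apply: continuousM => //; exact: cst_continuous.
Qed.

Lemma continuous_lens_primitive x : x != 0 -> {for x, continuous lens_primitive}.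
Proof.
move=> x0; apply: continuousM; first exact: cst_continuous.
apply: continuousB; first by apply: continuous_atan_sqrtB; rewrite mul1r.
apply: continuousM; first exact: cst_continuous.
by apply: continuous_atan_sqrtB; rewrite mulf_neq0// gt_eqF.
Qed.

Lemma integral_cap (b0 b1 : bool) (a : R) : 0 <= a -> a ^+ 2 < S2 -> a < 1 ->
  (\int[mu]_(x in [set` Interval (BSide b0 (- a)%R) (BSide b1 a)])
    (cap_density x)%:E = (2 * cap_primitive a)%:E)%E.
Proof.
move=> a0 aS a1.
have sq x : - a <= x <= a -> x ^+ 2 < S2 /\ x ^+ 2 < 1.
  rewrite -ler_norml => xa; rewrite -real_normK ?num_real//; split.
    by apply: le_lt_trans aS; rewrite ler_pXn2r ?nnegrE.
  rewrite expr_lt1//; exact: le_lt_trans a1.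
have -> : 2 * cap_primitive a = cap_primitive a - cap_primitive (- a).
  by rewrite cap_primitiveN; ring.
apply: integral_itv_FTC.
- by rewrite ge0_cp.
- by move=> x /sq [_ ?]; exact: continuous_cap_density.
- by move=> x /sq [? ?]; apply: is_derive_continuous; exact: is_derive_cap_primitive.
- move=> x /andP[ax xa]; have [|? ?] := sq x; first by rewrite !ltW.
  exact: is_derive_cap_primitive.
Qed.

(** The condition 0 < a b keeps the interval away from 0, where the arguments q / (k x) have a
    pole. *)
Lemma integral_lens (b0 b1 : bool) (a b : R) : a <= b -> 0 < a * b ->
  a ^+ 2 <= S2 -> b ^+ 2 <= S2 ->
  (\int[mu]_(x in [set` Interval (BSide b0 a) (BSide b1 b)])
    (lens_density x)%:E = (lens_primitive b - lens_primitive a)%:E)%E.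
Proof.
move=> ab ab0 aS bS.
have x0 x : a <= x <= b -> x != 0.
  by move=> /andP[ax xb]; apply/eqP => x0; rewrite x0 in ax xb; nra.
apply: integral_itv_FTC => //.
- by move=> x _; exact: continuous_lens_density.
- by move=> x /x0; exact: continuous_lens_primitive.
- move=> x /andP[ax xb]; apply: is_derive_lens_primitive.
    by apply: x0; rewrite !ltW.
  (* The bound x ^ 2 < S2 comes from the end farther from 0: b on the positive side, a on the
     negative one. *)
  have [a0|a0] := ltP 0 a.
    have : 0 < (b - x) * (b + x) by apply: mulr_gt0; lra.
    by lra.
  have b0' : b < 0 by nra.
  have : 0 < (x - a) * (- a - x) by apply: mulr_gt0; lra.
  by lra.
Qed.

End primitives.

(** * Areas in the fundamental domain *)

Section regions.
Context {R : realType}.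
Notation mu := (@lebesgue_measure R).

Lemma sqr_lt_norm (u v : R) : 0 <= v -> (u ^+ 2 < v ^+ 2) = (`|u| < v).
Proof. by move=> v0; rewrite -real_normK ?num_real// ltr_pXn2r ?nnegrE. Qed.

Lemma sqr_le_norm (u v : R) : 0 <= v -> (u ^+ 2 <= v ^+ 2) = (`|u| <= v).
Proof. by move=> v0; rewrite -real_normK ?num_real// ler_pXn2r ?nnegrE. Qed.

Lemma integral_hyp_strip (D : set (R * R)) (E : set R) (h : R -> R) :
  measurable D -> measurable E -> D `<=` [set p | 0 < p.2] ->
  (forall x, E x ->
    (\int[mu]_(y in [set y | D (x, y)]) (y ^- 2)%:E = (h x)%:E)%E) ->
  (\int[mu \x mu]_(p in D `&` fst @^-1` E) (p.2 ^- 2)%:E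
   = \int[mu]_(x in E) (h x)%:E)%E.
Proof.
move=> mD mE D0 hE; apply: integral_hyp_fibration.
- by apply: measurableI => //; rewrite -[X in measurable X]setTI; exact: measurable_fst.
- by move=> p [/D0].
- move=> x Ex; rewrite -hE//; congr (\int[mu]_(y in _) _)%E.
  by apply/seteqP; split=> y /= => [[]|].
- by move=> x Ex; apply/seteqP; split=> y //= -[].
Qed.

Lemma integral_hyp_split (D : set (R * R)) (t m : R) :
  measurable D -> D `<=` [set p | 0 < p.2] ->
  (forall p, D p -> - m < p.1 <= m) -> 0 <= t -> t <= m ->
  (\int[mu \x mu]_(p in D) (p.2 ^- 2)%:E =
   \int[mu \x mu]_(p in D `&` fst @^-1` `](- m)%R, (- t)%R]) (p.2 ^- 2)%:E +
   \int[mu \x mu]_(p in D `&` fst @^-1` `](- t)%R, t]) (p.2 ^- 2)%:E +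
   \int[mu \x mu]_(p in D `&` fst @^-1` `]t, m]) (p.2 ^- 2)%:E)%E.
Proof.
move=> mD D0 Dm t0 tm.
have mS (E : set R) : measurable E -> measurable (D `&` fst @^-1` E).
  move=> mE; apply: measurableI => //.
  by rewrite -[X in measurable X]setTI; exact: measurable_fst.
have ioc (x a b : R) : x \in `]a, b] -> a < x <= b by rewrite in_itv.
have DE : D = (D `&` fst @^-1` `](- m)%R, (- t)%R]) `|`
    (D `&` fst @^-1` `](- t)%R, t]) `|` (D `&` fst @^-1` `]t, m]).
  apply/seteqP; split=> [p Dp|p [[[]|[]]|[]]//].
  have /andP[mp pm] := Dm _ Dp; rewrite /= !in_itv/= mp pm !andbT.
  have [h|h] := leP p.1 (- t); first by left; left.
  by have [h'|h'] := leP p.1 t; [left; right|right].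
have p0 (p : R * R) : (0 <= (p.2 ^- 2)%:E :> \bar R)%E.
  by rewrite lee_fin invr_ge0 sqr_ge0.
have mf : measurable_fun D (fun p : R * R => (p.2 ^- 2)%:E).
  exact: measurable_hyp_density.
rewrite [in LHS]DE ge0_integral_setU//=; first last.
- apply/disj_setPS => p [] /= pE [_ /ioc/andP[h2 _]]; apply/negP: h2.
  by rewrite -leNgt; case: pE => -[_ /= /ioc/andP[_ h1]] //; apply: le_trans h1 _; lra.
- by rewrite -DE.
- by apply: mS.
- by apply: measurableU; apply: mS.
congr (_ + _)%E; rewrite ge0_integral_setU//=.
- by apply: mS.
- by apply: mS.
- by apply: measurable_funS mf => // p [[]|[]].
- by apply/disj_setPS => p [] /= [_ /ioc/andP[_ h1]] [_ /ioc/andP[h2 _]]; lra.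
Qed.

Lemma measurable_fiber (D : set (R * R)) (x : R) :
  measurable D -> measurable [set y | D (x, y)].
Proof.
move=> mD; rewrite (_ : [set y | _] = xsection D x); last first.
  by rewrite /xsection; apply/seteqP; split=> y /= => [|/set_mem]; rewrite ?inE.
exact: measurable_xsection.
Qed.

Definition fundamental_region : set (R * R) :=
  [set p | [/\ 0 < p.2, 1 <= p.1 ^+ 2 + p.2 ^+ 2 & - (1 / 2) < p.1 <= 1 / 2]].

Definition disc_region (c : R) : set (R * R) :=
  fundamental_region `&` [set p | p.1 ^+ 2 + p.2 ^+ 2 + 1 < 2 * p.2 * c].

Lemma integral_fundamental_region : measurable fundamental_region ->
  (\int[mu \x mu]_(p in fundamental_region) (p.2 ^- 2)%:E = (pi / 3)%:E)%E.
Proof.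
move=> mF.
have r_gt0 (x : R) : - (1 / 2) <= x <= 1 / 2 -> x ^+ 2 < 1.
  move=> /andP[? ?]; nra.
rewrite (@integral_hyp_fibration _ _ `](- (1 / 2)), (1 / 2)]
  (fun x => (Num.sqrt (1 - x ^+ 2))^-1))//.
- have -> : pi / 3 = atan (1 * (1 / 2) / Num.sqrt (1 - (1 / 2) ^+ 2))
      - atan (1 * (- (1 / 2)) / Num.sqrt (1 - (- (1 / 2)) ^+ 2)) :> R.
    by rewrite sqrrN mulrN mulNr atanN opprK [1 * (1 / 2)]mul1r atan_inv_sqrt3; field.
  apply: (@integral_itv_FTC _ false false _
    (fun x => atan (1 * x / Num.sqrt (1 - x ^+ 2)))).
  + by lra.
  + move=> x /r_gt0 x1; apply: continuousV; last exact: continuous_sqrtB.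
    by rewrite gt_eqF// sqrtr_gt0 subr_gt0.
  + by move=> x /r_gt0 x1; exact: is_derive_continuous (is_derive_atan_div 1 x1).
  + move=> x /andP[x1 x2]; have {}x1 : x ^+ 2 < 1 by apply: r_gt0; rewrite !ltW.
    apply: (is_derive_eq (is_derive_atan_div 1 x1)).
    have r0 : Num.sqrt (1 - x ^+ 2) != 0 by rewrite gt_eqF// sqrtr_gt0 subr_gt0.
    have r2 : Num.sqrt (1 - x ^+ 2) ^+ 2 = 1 - x ^+ 2.
      by rewrite sqr_sqrtr// subr_ge0 ltW.
    by rewrite r2 !mul1r subrK mulr1.
- by move=> p [].
- move=> x /= /[!in_itv]/= /andP[x1 x2].
  have {}xlt : x ^+ 2 < 1 by apply: r_gt0; rewrite x2 ltW.
  have r0 : 0 < Num.sqrt (1 - x ^+ 2) by rewrite sqrtr_gt0 subr_gt0.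
  rewrite -integral_hyp_fibery//; congr (\int[mu]_(y in _) _)%E.
  have r2 : Num.sqrt (1 - x ^+ 2) ^+ 2 = 1 - x ^+ 2.
    by rewrite sqr_sqrtr// subr_ge0 ltW.
  apply/seteqP; split=> y /=; rewrite in_itv/= andbT.
  + move=> [/= y0 yx _]; rewrite -(ger0_norm (ltW r0)) -sqr_le_norm ?(ltW y0)// r2.
    by lra.
  + move=> ry; split => /=; [exact: lt_le_trans ry| |by rewrite x1].
    have : Num.sqrt (1 - x ^+ 2) ^+ 2 <= y ^+ 2.
      by rewrite ler_pXn2r ?nnegrE ?(ltW r0)// (le_trans (ltW r0)).
    by rewrite r2; lra.
- move=> x; rewrite /= in_itv/= => xE; apply/seteqP; split=> y //= -[/= _ _].
  by move=> /xE.
Qed.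

(** * Fibres and area of a disc about i inside the domain *)

Section disc.
Variables (c S2 : R).
Hypotheses (c1 : 1 <= c) (S0 : 0 < S2) (cS : c ^+ 2 = S2 + 1).
Hypothesis mD : measurable (disc_region c).
Let q (x : R) : R := Num.sqrt (S2 - x ^+ 2).
Let c0 : 0 < c. Proof. exact: lt_le_trans c1. Qed.

(** Completing the square shows the Euclidean disc x ^ 2 + (y - c) ^ 2 < S2, of centre c i and
    radius sinh r. *)
Lemma disc_regionE (x y : R) : x ^+ 2 <= S2 ->
  (x ^+ 2 + y ^+ 2 + 1 < 2 * y * c) = (c - q x < y < c + q x).
Proof.
move=> xS; have q2 : q x ^+ 2 = S2 - x ^+ 2 by rewrite sqr_sqrtr// subr_ge0.
rewrite -ltr_distlC distrC -sqr_lt_norm ?sqrtr_ge0// q2 -[S2](addrK 1) -cS.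
by rewrite -subr_gt0 -[RHS]subr_gt0; congr (0 < _); ring.
Qed.

Lemma add_sqrt_inv (x : R) : x ^+ 2 <= S2 -> (c + q x)^-1 = (c - q x) / (1 + x ^+ 2).
Proof.
move=> xS; have q2 : q x ^+ 2 = S2 - x ^+ 2 by rewrite sqr_sqrtr// subr_ge0.
have q0 : 0 <= q x := sqrtr_ge0 _.
have cq : 0 < c - q x.
  rewrite subr_gt0 -(ger0_norm q0) -sqr_lt_norm ?(ltW c0)// q2 cS.
  by have := sqr_ge0 x; lra.
have -> : 1 + x ^+ 2 = (c - q x) * (c + q x).
  have -> : (c - q x) * (c + q x) = c ^+ 2 - q x ^+ 2 by ring.
  by rewrite q2 cS; ring.
by field; rewrite !gt_eqF// ltr_wpDr.
Qed.

(** The condition |x| <= tanh r amounts to 1 <= r c for r = sqrt (1 - x ^ 2), hence to (c - r) ^ 2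
    <= q ^ 2: the unit circle is not below the lower arc of the disc. It is not above the upper arc
    because r <= 1 <= c + q. *)
Lemma integral_cap_fiber (x : R) : - (1 / 2) < x <= 1 / 2 -> (c * x) ^+ 2 <= S2 ->
  (\int[mu]_(y in [set y | disc_region c (x, y)]) (y ^- 2)%:E
   = (cap_density c S2 x)%:E)%E.
Proof.
move=> xE cxS; have xS : x ^+ 2 <= S2.
  apply: le_trans cxS; rewrite exprMn ler_peMl ?sqr_ge0//.
  by rewrite expr_ge1// ltW.
have x1 : x ^+ 2 < 1 by move: xE => /andP[? ?]; nra.
have q2 : q x ^+ 2 = S2 - x ^+ 2 by rewrite sqr_sqrtr// subr_ge0.
have q0 : 0 <= q x := sqrtr_ge0 _.
pose r : R := Num.sqrt (1 - x ^+ 2).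
have r0 : 0 < r by rewrite sqrtr_gt0 subr_gt0.
have r2 : r ^+ 2 = 1 - x ^+ 2 by rewrite sqr_sqrtr// subr_ge0 ltW.
have rc : 1 <= r * c.
  rewrite -[X in X <= _]normr1 -sqr_le_norm; last by rewrite mulr_ge0// ltW.
  by rewrite expr1n exprMn r2; move: cxS; rewrite exprMn cS; lra.
have crq : c - r <= q x.
  apply: le_trans (ler_norm _) _; rewrite -sqr_le_norm// q2.
  have -> : (c - r) ^+ 2 = c ^+ 2 + r ^+ 2 - 2 * (r * c) by ring.
  by rewrite cS r2; lra.
have rcq : r <= c + q x.
  apply: le_trans (_ : 1 <= _); last by rewrite -[1]addr0 lerD.
  by rewrite -[r]ger0_norm ?(ltW r0)// -sqr_le_norm// r2 expr1n; have := sqr_ge0 x; lra.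
rewrite (@integral_hyp_fiber _ _ r (c + q x))//.
- by rewrite add_sqrt_inv.
- exact: measurable_fiber.
- move=> y /= /[!in_itv]/= /andP[ry yq].
  have y0 : 0 < y by exact: lt_trans ry.
  split; last by rewrite /= disc_regionE// yq andbT; lra.
  split => //=; have : r ^+ 2 <= y ^+ 2 by rewrite ler_pXn2r ?nnegrE ?ltW.
  by rewrite r2; lra.
- move=> y /= [[/= y0 xy _]] /=; rewrite disc_regionE// in_itv/= => /andP[_ yq].
  rewrite (ltW yq) andbT -[r]ger0_norm ?(ltW r0)// -sqr_le_norm ?(ltW y0)// r2.
  by lra.
Qed.

(** With the inequalities of [integral_cap_fiber] reversed, r c <= 1 places the lower arc of the
    disc on or above the unit circle, and the fibre is a full chord. *)
Lemma integral_lens_fiber (x : R) : - (1 / 2) < x <= 1 / 2 -> S2 <= (c * x) ^+ 2 ->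
  x ^+ 2 <= S2 ->
  (\int[mu]_(y in [set y | disc_region c (x, y)]) (y ^- 2)%:E
   = (lens_density S2 x)%:E)%E.
Proof.
move=> xE cxS xS.
have x1 : x ^+ 2 < 1 by move: xE => /andP[? ?]; nra.
have q2 : q x ^+ 2 = S2 - x ^+ 2 by rewrite sqr_sqrtr// subr_ge0.
have q0 : 0 <= q x := sqrtr_ge0 _.
pose r : R := Num.sqrt (1 - x ^+ 2).
have r0 : 0 < r by rewrite sqrtr_gt0 subr_gt0.
have r2 : r ^+ 2 = 1 - x ^+ 2 by rewrite sqr_sqrtr// subr_ge0 ltW.
have rc : r * c <= 1.
  apply: le_trans (ler_norm _) _; rewrite -sqr_le_norm//.
  by rewrite expr1n exprMn r2; move: cxS; rewrite exprMn cS; lra.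
have r1 : r <= 1.
  apply: le_trans (ler_norm _) _; rewrite -sqr_le_norm//.
  by rewrite r2 expr1n; have := sqr_ge0 x; lra.
have crq : q x <= c - r.
  rewrite -[q x]ger0_norm// -sqr_le_norm ?q2; last by have := c1; lra.
  have -> : (c - r) ^+ 2 = c ^+ 2 + r ^+ 2 - 2 * (r * c) by ring.
  by rewrite cS r2; lra.
have cq0 : 0 < c - q x by lra.
rewrite (@integral_hyp_fiber _ _ (c - q x) (c + q x))//.
- rewrite add_sqrt_inv// /lens_density -/(q x); congr (_%:E).
  have -> : 1 + x ^+ 2 = (c - q x) * (c + q x).
    have -> : (c - q x) * (c + q x) = c ^+ 2 - q x ^+ 2 by ring.
    by rewrite q2 cS; ring.
  by field; rewrite !gt_eqF// ltr_wpDr.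
- by lra.
- exact: measurable_fiber.
- move=> y /= /[!in_itv]/= /andP[ry yq].
  have y0 : 0 < y by exact: lt_trans ry.
  split; last by rewrite /= disc_regionE// yq ry.
  split => //=; have : r ^+ 2 <= y ^+ 2 by rewrite ler_pXn2r// ?nnegrE; lra.
  by rewrite r2; lra.
- move=> y /= [[/= y0 xy _]] /=; rewrite disc_regionE// in_itv/= => /andP[ry yq].
  by rewrite !ltW.
Qed.

(** From 1/3 <= S2, that is 1/2 <= tanh r, one gets c ^ 2 x ^ 2 <= (S2 + 1) / 4 <= S2 for |x| <=
    1/2, so every fibre is cut by the unit circle. *)
Lemma integral_disc_region_large : 1 / 3 <= S2 ->
  (\int[mu \x mu]_(p in disc_region c) (p.2 ^- 2)%:E
   = (2 * cap_primitive c S2 (1 / 2))%:E)%E.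
Proof.
move=> S3; rewrite -(integral_cap cS false false); [|by lra..].
apply: integral_hyp_fibration => //.
- by move=> p [[]].
- move=> x /=; rewrite in_itv/= => xE; apply: integral_cap_fiber => //.
  have x2 : x ^+ 2 <= 1 / 4 by move: xE => /andP[? ?]; nra.
  have : 0 <= (1 / 4 - x ^+ 2) * (S2 + 1) by apply: mulr_ge0; lra.
  by rewrite exprMn cS; lra.
- by move=> x xE; apply/seteqP; split=> y //= -[[/= _ _]]; rewrite /= in_itv/= in xE.
Qed.

(* [m] is the smaller of [sinh r] and [1/2]; [c - 1 = 2 sinh (r / 2) ^+ 2]. *)
Lemma integral_disc_region_small m : S2 <= 1 / 3 -> 0 < m -> m <= 1 / 2 ->
  m ^+ 2 <= S2 -> m = 1 / 2 \/ m ^+ 2 = S2 ->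
  (\int[mu \x mu]_(p in disc_region c) (p.2 ^- 2)%:E
   = ((c - 1) * pi + 2 * lens_primitive c S2 m)%:E)%E.
Proof.
move=> S3 m0 m12 mS mE.
set S := Num.sqrt S2; have Sgt0 : 0 < S by rewrite sqrtr_gt0.
have SS : S ^+ 2 = S2 by rewrite sqr_sqrtr// ltW.
(* Here t = tanh r, the abscissa where the lower arc of the disc meets the unit circle. *)
have [t tE] : exists t, t = S / c by exists (S / c).
have t0 : 0 < t by rewrite tE divr_gt0.
have ct : c * t = S by rewrite tE mulrC divfK// gt_eqF.
have t2 : t ^+ 2 < S2.
  rewrite -SS -ct exprMn cS mulrDl mul1r ltrDr.
  by rewrite mulr_gt0 ?exprn_gt0.
have tm : t <= m.
  rewrite -[t]ger0_norm ?(ltW t0)// -sqr_le_norm ?(ltW m0)//.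
  case: mE => [->|->]; last exact: ltW.
  rewrite tE expr_div_n SS cS ler_pdivrMr; last by have := S0; lra.
  by lra.
have D0 : disc_region c `<=` [set p | 0 < p.2] by move=> p [[]].
have Dm p : disc_region c p -> - m < p.1 <= m.
  move=> [[y0 xy x12]] /= pc; case: mE => [->//|mE].
  suff : `|p.1| < m by rewrite ltr_norml => /andP[-> /ltW].
  rewrite -sqr_lt_norm ?(ltW m0)// mE -subr_gt0.
  have : 0 <= (p.2 - c) ^+ 2 by rewrite sqr_ge0.
  have -> : (p.2 - c) ^+ 2 = p.2 ^+ 2 - 2 * p.2 * c + c ^+ 2 by ring.
  by rewrite cS; lra.
have in12 x : - m < x <= m -> - (1 / 2) < x <= 1 / 2.
  by move=> /andP[? ?]; apply/andP; split; lra.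
rewrite (integral_hyp_split mD D0 Dm (ltW t0) tm).
rewrite (@integral_hyp_strip _ _ (lens_density S2))//; last first.
  move=> x /=; rewrite in_itv/= => /andP[x1 x2].
  apply: integral_lens_fiber; first by apply: in12; rewrite x1/=; lra.
    rewrite -SS -ct !exprMn ler_pM2l ?exprn_gt0// -[x ^+ 2]sqrrN.
    by rewrite ler_pXn2r// ?nnegrE; lra.
  apply: le_trans mS; rewrite sqr_le_norm ?(ltW m0)// ler_norml ltW//=; lra.
rewrite (@integral_hyp_strip _ _ (cap_density c S2))//; last first.
  move=> x /=; rewrite in_itv/= => /andP[x1 x2].
  apply: integral_cap_fiber; first by apply: in12; lra.
  rewrite -SS -ct !exprMn ler_pM2l ?exprn_gt0// sqr_le_norm ?(ltW t0)//.
  by rewrite ler_norml x2 ltW.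
rewrite (@integral_hyp_strip _ _ (lens_density S2))//; last first.
  move=> x /=; rewrite in_itv/= => /andP[x1 x2].
  apply: integral_lens_fiber; first by apply: in12; lra.
    rewrite -SS -ct !exprMn ler_pM2l ?exprn_gt0//.
    by rewrite ler_pXn2r// ?nnegrE; lra.
  apply: le_trans mS; rewrite sqr_le_norm ?(ltW m0)// ler_norml x2 andbT; lra.
rewrite !(integral_lens c0 cS) ?sqrrN ?(ltW t2)//; first last.
- by rewrite mulrNN mulr_gt0.
- by rewrite lerN2.
- by rewrite mulr_gt0.
rewrite (integral_cap cS) ?(ltW t0)//; last by lra.
rewrite -!EFinD !lens_primitiveN; congr (_%:E).
have S21 : S2 + 1 != 0 by rewrite gt_eqF// addr_gt0.
(* Both square roots become rational at t, so the two primitives can be compared there. *)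
have qt : Num.sqrt (S2 - t ^+ 2) = S2 / c.
  rewrite -[RHS]ger0_norm; last by rewrite divr_ge0// ltW.
  rewrite -sqrtr_sqr; congr Num.sqrt; rewrite tE !expr_div_n SS cS.
  by field.
have rt : Num.sqrt (1 - t ^+ 2) = c^-1.
  rewrite -[RHS]ger0_norm ?invr_ge0 ?(ltW c0)// -sqrtr_sqr; congr Num.sqrt.
  by rewrite tE expr_div_n exprVn SS cS; field.
have -> : cap_primitive c S2 t =
    atan S - c * atan (S / c) + c * atan (c / S) - atan S^-1.
  rewrite /cap_primitive qt rt -tE; congr (atan _ - _ + c * atan _ - atan _).
  - by rewrite tE; field; rewrite gt_eqF.
  - by rewrite ct -SS; field; rewrite !gt_eqF.
  - by rewrite tE -SS; field; rewrite !gt_eqF.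
have -> : lens_primitive c S2 t = 2 * (atan S - c * atan (S / c)).
  rewrite /lens_primitive qt; congr (2 * (atan _ - c * atan _)).
  - by rewrite tE -SS; field; rewrite !gt_eqF.
  - by rewrite ct -SS; field; rewrite !gt_eqF.
(* After reflecting c / S and 1 / S, the values at t cancel between the cap and the two lenses,
   except for (c - 1) pi. *)
rewrite -[c / S]invf_div !atanV ?divr_gt0//.
by lra.
Qed.

End disc.
End regions.

(** * Law of the distance *)

Section uniform_law.
Context {R : realType}.
Notation mu := (@lebesgue_measure R).
Notation pi_moduli := (\pi_(moduli R)).

Lemma measurable_lt_fun d (T : measurableType d) (f g : T -> R) :
  measurable_fun setT f -> measurable_fun setT g -> measurable [set x | f x < g x].
Proof.
move=> mf mg; rewrite (_ : [set x | _] = ~` [set x | g x <= f x]); last first.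
  by apply/seteqP; split=> x /=; rewrite ltNge => /negP.
by apply: measurableC; rewrite -[X in measurable X]setTI; exact: measurable_fun_le.
Qed.

(** The preimage in the half-plane is a union, over the countably many integer matrices, of sets cut
    out by a polynomial inequality. The lemma lets the uniformity hypothesis, which concerns
    measurable sets, be applied to balls. *)
Lemma measurable_moduli_ball (r : R) : 0 <= r ->
  measurable [set b : moduli R | moduli_dist b (i_star R) < r].
Proof.
move=> r0; rewrite /measurable/= /moduli_measurable/=.
rewrite (_ : _ @^-1` _ = \bigcup_(g : 'M[int]_2) [set z : uhp R | \det g = 1 /\
    lattice_sqnorm (g 0 0) (g 0 1) z + lattice_sqnorm (g 1 0) (g 1 1) z
    < 2 * complex.Im z * cosh r]); last first.
  apply/seteqP; split=> z /=.
    by move=> /(moduli_dist_lt _ r0)[g ? ?]; exists g.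
  by move=> [g _ [? ?]]; apply/(moduli_dist_lt _ r0); exists g.
apply: countable_bigcupT_measurable; first exact: countableP.
move=> g; have [detg|detg] := pselect (\det g = 1); last first.
  rewrite (_ : [set z | _] = set0)//.
  by apply/seteqP; split=> z // -[].
pose N (m n : int) (p : R * R) := (m%:~R * p.1 + n%:~R) ^+ 2 + (m%:~R * p.2) ^+ 2.
have mN m n : measurable_fun setT (N m n).
  apply: measurable_funD; apply: measurable_funX.
    apply: measurable_funD; last exact: measurable_cst.
    by apply: measurable_funM => //; exact: measurable_fst.
  by apply: measurable_funM => //; exact: measurable_snd.
rewrite (_ : [set z | _] = @uhp_coords R @^-1` [set p |
    N (g 0 0) (g 0 1) p + N (g 1 0) (g 1 1) p < 2 * p.2 * cosh r]); last first.
  by apply/seteqP; split=> z /=; rewrite !lattice_sqnormE; [case|].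
rewrite -[X in measurable X]setTI; apply: measurable_uhp_coords => //.
apply: measurable_lt_fun; first exact: measurable_funD.
apply: measurable_funM; last exact: measurable_cst.
by apply: measurable_funM => //; exact: measurable_snd.
Qed.

Lemma image_fundamental_domain (P : set (R * R)) :
  @uhp_coords R @` ([set z | P (uhp_coords z)] `&` fundamental_domain)
  = fundamental_region `&` P.
Proof.
have nrm (x y : R) : (1 <= normc (Complex x y)) = (1 <= x ^+ 2 + y ^+ 2).
  by rewrite /= -[X in X <= _]sqrtr1 ler_sqrt// addr_ge0 ?sqr_ge0.
apply/seteqP; split=> [_ [[[x y] /= y0] [Pz [z1 xE]] <-]|[x y] [[/= y0 xy xE] Pxy]].
  by split=> //; split=> //=; rewrite -nrm.
by exists (@Uhp R (Complex x y) y0) => //; split => //; split => //; rewrite nrm.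
Qed.

Lemma measurable_fundamental_region : measurable (@fundamental_region R).
Proof.
have := measurable_image_uhp_coords (@measurable_fundamental_domain R).
by rewrite -[fundamental_domain]setTI (image_fundamental_domain setT) setIT.
Qed.

Let ball (r : R) : set (moduli R) := [set b | moduli_dist b (i_star R) < r].

Lemma ballE (r : R) : 0 <= r ->
  @uhp_coords R @` (pi_moduli @^-1` ball r `&` fundamental_domain)
  = disc_region (cosh r).
Proof.
move=> r0; rewrite /disc_region -image_fundamental_domain; congr (_ @` _).
have E z : fundamental_domain z -> ball r (pi_moduli z) <->
    complex.Re z ^+ 2 + complex.Im z ^+ 2 + 1 < 2 * complex.Im z * cosh r.
  by move=> fz; rewrite /ball /= moduli_dist_lt_fundamental// sqr_normc.
by apply/seteqP; split=> z [/= zr fz]; split=> //=; apply/(E z fz).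
Qed.

Lemma measurable_disc_region (r : R) : 0 <= r ->
  measurable (disc_region (cosh r)).
Proof.
move=> r0; rewrite -ballE//; apply: measurable_image_uhp_coords.
apply: measurableI; last exact: measurable_fundamental_domain.
exact: measurable_moduli_ball.
Qed.

Lemma moduli_areaE (B : set (moduli R)) : moduli_area B =
  (\int[mu \x mu]_(p in @uhp_coords R @` (pi_moduli @^-1` B `&` fundamental_domain))
    (p.2 ^- 2)%:E)%E.
Proof. by []. Qed.

Lemma moduli_areaT : moduli_area [set: moduli R] = (pi / 3)%:E.
Proof.
rewrite moduli_areaE preimage_setT (image_fundamental_domain setT) setIT.
exact: integral_fundamental_region measurable_fundamental_region.
Qed.

Lemma mnormalizeE d (T : measurableType d) (m : measure T R)
    (P : probability T R) (U : set T) (a b : R) :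
  m setT = a%:E -> a != 0 -> m U = b%:E -> mnormalize m P U = (b / a)%:E.
Proof.
by move=> mT a0 mU; rewrite /mnormalize mT eqe (negbTE a0)/= mU -EFinM.
Qed.

Lemma moduli_uniform_ball (r a : R) : 0 <= r ->
  (\int[mu \x mu]_(p in disc_region (cosh r)) (p.2 ^- 2)%:E = a%:E)%E ->
  moduli_uniform R (ball r) = (3 / pi * a)%:E.
Proof.
move=> r0 ra; have pi0 : (pi : R) != 0 by rewrite gt_eqF// pi_gt0.
have -> : 3 / pi * a = a / (pi / 3) by rewrite invf_div mulrC.
apply: mnormalizeE; [exact: moduli_areaT|by rewrite mulf_neq0// invr_neq0|].
by rewrite [LHS]moduli_areaE ballE.
Qed.

End uniform_law.

(** * Closed forms of the distribution function *)

Section distribution_function.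
Context {R : realType}.
Implicit Types c s r : R.

(* [c = cosh r], [S2 = sinh r ^+ 2], [s = sqrt (2 cosh (2 r) - 3)] *)
Lemma atan_large_radius c s (S2 : R) : 0 < c -> 0 < s -> 1 / 3 <= S2 ->
  c ^+ 2 = S2 + 1 -> s ^+ 2 = 4 * S2 - 1 ->
  atan (4 * (2 * S2 + c * s) / (4 - 6 * S2 - 16 * S2 ^+ 2 - 8 * S2 * (c * s)))
  = - (2 * (atan (c / s) - atan (1 / 2))).
Proof.
move=> c0 s0 S3 c2 s2; have cs0 : 0 < c * s by rewrite mulr_gt0.
have p2 : (c * s) ^+ 2 = (S2 + 1) * (4 * S2 - 1) by rewrite exprMn c2 s2.
(* The bound 2/3 is the value of c s at S2 = 1/3; it fixes the signs of the two denominators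
   below. *)
have p1 : 2 / 3 <= c * s.
  rewrite -(@ler_pXn2r _ 2) ?nnegrE ?(ltW cs0)// p2.
  have : 0 <= (S2 - 1 / 3) * (4 * S2 + 13 / 3) by apply: mulr_ge0; lra.
  by lra.
have den0 : 4 - 6 * S2 - 16 * S2 ^+ 2 - 8 * S2 * (c * s) < 0.
  have : 0 <= (S2 - 1 / 3) * (c * s - 2 / 3) by apply: mulr_ge0; lra.
  have : 0 <= (S2 - 1 / 3) * (16 * S2) by apply: mulr_ge0; lra.
  by lra.
rewrite atanB ?divr_ge0 ?(ltW c0) ?(ltW s0)//.
have uE : (c / s - 1 / 2) / (1 + c / s * (1 / 2)) = (2 * c - s) / (2 * s + c).
  by field; rewrite !gt_eqF// addr_gt0// mulr_gt0.
(* Together with s < 2 c, this places (2 c - s) / (2 s + c) in (0, 1), where the arctangent may be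
   doubled. *)
have cs : c < 3 * s.
  by rewrite -(@ltr_pXn2r _ 2) ?nnegrE ?mulr_ge0 ?ltW// exprMn c2 s2; lra.
have sc0 : 0 < 2 * s + c by lra.
have s2c : s < 2 * c.
  by rewrite -(@ltr_pXn2r _ 2) ?nnegrE ?mulr_ge0 ?ltW// exprMn c2 s2; lra.
rewrite uE atan_double; last first.
  rewrite (lt_trans (_ : -1 < 0)) ?ltrN10 ?divr_gt0 ?subr_gt0//=.
  by rewrite ltr_pdivrMr// mul1r; lra.
rewrite -atanN; congr atan.
have d1 : 9 * S2 - 6 + 8 * (c * s) != 0 by rewrite gt_eqF//; lra.
have -> : 2 * ((2 * c - s) / (2 * s + c)) / (1 - ((2 * c - s) / (2 * s + c)) ^+ 2)
   = 2 * (4 - 6 * S2 + 3 * (c * s)) / (9 * S2 - 6 + 8 * (c * s)).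
  have -> : 4 - 6 * S2 + 3 * (c * s) = (2 * c - s) * (2 * s + c).
    have -> : (2 * c - s) * (2 * s + c) = 2 * c ^+ 2 - 2 * s ^+ 2 + 3 * (c * s) by ring.
    by rewrite c2 s2; ring.
  have dE : 9 * S2 - 6 + 8 * (c * s) = (2 * s + c) ^+ 2 - (2 * c - s) ^+ 2.
    have -> : (2 * s + c) ^+ 2 - (2 * c - s) ^+ 2
      = 3 * s ^+ 2 - 3 * c ^+ 2 + 8 * (c * s) by ring.
    by rewrite c2 s2; ring.
  rewrite dE in d1 *; field.
  by rewrite d1 gt_eqF.
rewrite -[RHS]mulNr; apply/eqP; rewrite eqr_div ?(lt_eqF den0)//.
rewrite -subr_eq0.
(* The cross-multiplied difference is a multiple of the relation [p2]. *)
have -> : 4 * (2 * S2 + c * s) * (9 * S2 - 6 + 8 * (c * s)) -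
  - (2 * (4 - 6 * S2 + 3 * (c * s))) *
  (4 - 6 * S2 - 16 * S2 ^+ 2 - 8 * S2 * (c * s)) =
  (32 - 48 * S2) * ((c * s) ^+ 2 - (S2 + 1) * (4 * S2 - 1)) by ring.
by rewrite p2 subrr mulr0.
Qed.

Lemma cosh_quadruple r : cosh (4 * r) = 2 * cosh (2 * r) ^+ 2 - 1.
Proof.
have -> : 4 * r = 2 * (2 * r) by ring.
by rewrite cosh_double sqr_cosh; ring.
Qed.

(** The square root of the theorem is, once sinh r >= 1/2, the length of the chord of the disc on
    the line x = 1/2. *)
Lemma sqrt_double_cosh r : Num.sqrt (2 * cosh (2 * r) - 3) =
  2 * Num.sqrt (sinh r ^+ 2 - (1 / 2) ^+ 2).
Proof.
rewrite cosh_double; move: (sinh r) => x.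
have -> : 2 * (2 * x ^+ 2 + 1) - 3 = 2 ^+ 2 * (x ^+ 2 - (1 / 2) ^+ 2) by field.
by rewrite sqrtrM ?sqr_ge0// sqrtr_sqr ger0_norm.
Qed.

Lemma sinh_gt0 r : 0 < r -> 0 < sinh r.
Proof. by move=> r0; rewrite -[0]sinh0 (leW_mono sinh_mono). Qed.

(** As [lens_primitive] vanishes at sinh r, only the area pi (cosh r - 1) remains, half that of a
    hyperbolic disc, as expected at a cone point of order two. *)
Lemma moduli_uniform_ball_tiny r : 0 <= r <= arsinh (1 / 2) ->
  moduli_uniform R [set b | moduli_dist b (i_star R) < r]
  = (6 * sinh (r / 2) ^+ 2)%:E.
Proof.
rewrite le_arsinh => /andP[r0 r1].
have -> : 6 * sinh (r / 2) ^+ 2 = 3 / pi * ((cosh r - 1) * pi).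
  rewrite (cosh_half r); move: (sinh _) (pi) (@pi_gt0 R) => x p p0.
  by field; rewrite gt_eqF.
apply: moduli_uniform_ball => //.
(* For r = 0 the hypothesis 0 < S2 of the area formula fails; the region is empty, since x ^ 2 + (y
   - 1) ^ 2 < 0 is impossible. *)
move: r0; rewrite le_eqVlt => /predU1P[r0|r0].
  rewrite -r0 (_ : cosh 0 = 1); last by rewrite /cosh oppr0 expR0; field.
  rewrite subrr mul0r (_ : disc_region 1 = set0) ?integral_set0//.
  apply/seteqP; split=> p // [_ /=]; have := sqr_ge0 (p.2 - 1).
  by have := sqr_ge0 p.1; rewrite !expr2; lra.
have S0 := sinh_gt0 r0.
have S2 : sinh r ^+ 2 <= 1 / 3.
  apply: le_trans (_ : (1 / 2) ^+ 2 <= _); last by rewrite expr2; lra.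
  by rewrite ler_pXn2r ?nnegrE// ltW.
rewrite (integral_disc_region_small (cosh_ge1 r) _ (sqr_cosh r)
  (measurable_disc_region (ltW r0)) (m := sinh r)) ?exprn_gt0//; last by right.
by rewrite /lens_primitive subrr sqrtr0 !mul0r atan0 mulr0 subr0 !mulr0 addr0.
Qed.

Lemma lens_primitive_half c (S2 : R) : 0 < c ->
  let s := 2 * Num.sqrt (S2 - (1 / 2) ^+ 2) in
  lens_primitive c S2 (1 / 2) = 2 * (atan s - c * atan (s / c)).
Proof.
move=> c0 /=; rewrite /lens_primitive; move: (Num.sqrt _) => q.
by congr (2 * (atan _ - c * atan _)); field; rewrite ?gt_eqF.
Qed.

Lemma cap_primitive_half c (S2 : R) : (1 / 2) ^+ 2 < S2 ->
  let s := 2 * Num.sqrt (S2 - (1 / 2) ^+ 2) in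
  cap_primitive c S2 (1 / 2) =
  pi / 6 - atan (1 / s) + c * (atan (c / s) - atan (1 / 2)).
Proof.
move=> S4 s; rewrite /cap_primitive -atan_inv_sqrt3.
have q0 : 0 < Num.sqrt (S2 - (1 / 2) ^+ 2) by rewrite sqrtr_gt0 subr_gt0.
have -> : c * (1 / 2) / Num.sqrt (S2 - (1 / 2) ^+ 2) = c / s.
  by rewrite /s; field; rewrite gt_eqF.
have -> : 1 * (1 / 2) / Num.sqrt (S2 - (1 / 2) ^+ 2) = 1 / s.
  by rewrite /s; field; rewrite gt_eqF.
by rewrite (mul1r (1 / 2)); ring.
Qed.

Lemma moduli_uniform_ball_small r :
  arsinh (1 / 2) <= r <= arsinh (1 / Num.sqrt 3) ->
  moduli_uniform R [set b | moduli_dist b (i_star R) < r]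
  = (6 * sinh (r / 2) ^+ 2
     - 6 / pi * cosh r
       * atan (4 * cosh r * Num.sqrt (2 * cosh (2 * r) - 3)
               / (7 - 3 * cosh (2 * r)))
     + 12 / pi * atan (Num.sqrt (2 * cosh (2 * r) - 3)))%:E.
Proof.
rewrite le_arsinh arsinh_le => /andP[r0 r1].
have S0 : 0 < sinh r by apply: lt_le_trans r0.
have rge0 : 0 <= r by rewrite -sinh_mono sinh0 ltW.
have S3 : sinh r ^+ 2 <= 1 / 3.
  have -> : 1 / 3 = (1 / Num.sqrt 3) ^+ 2 :> R.
    by rewrite expr_div_n sqr_sqrtr// expr1n.
  by rewrite sqr_le_norm ?divr_ge0 ?sqrtr_ge0// ger0_norm ?(ltW S0).
have S4 : (1 / 2) ^+ 2 <= sinh r ^+ 2.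
  by rewrite (sqr_le_norm _ (ltW S0)) ger0_norm.
rewrite (moduli_uniform_ball rge0 (integral_disc_region_small (cosh_ge1 r) _
  (sqr_cosh r) (measurable_disc_region rge0) (m := 1 / 2) _ _ _ _ _)) ?exprn_gt0//;
  last by left.
have c0 := cosh_gt0 r.
rewrite lens_primitive_half// -sqrt_double_cosh.
have sE : Num.sqrt (2 * cosh (2 * r) - 3) ^+ 2 = 4 * sinh r ^+ 2 - 1.
  by rewrite sqr_sqrtr cosh_double; [ring|rewrite expr2 in S4; lra].
have := cosh_half r; move: sE (sqrtr_ge0 (2 * cosh (2 * r) - 3)).
rewrite cosh_double; move: (Num.sqrt _) => s s2 s0.
have := sqr_cosh r; move: (cosh r) c0 => c c0 c2.
move: (sinh (r / 2)) => h hE.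
(* Half of 7 - 3 cosh (2 r) is c ^ 2 - s ^ 2, so this is the tangent of 2 atan (s / c); here s < c
   because sinh r ^ 2 <= 1/3. *)
have -> : 4 * c * s / (7 - 3 * (2 * sinh r ^+ 2 + 1)) =
  2 * (s / c) / (1 - (s / c) ^+ 2).
  have d0 : c ^+ 2 - s ^+ 2 != 0 by rewrite c2 s2 gt_eqF//; lra.
  have -> : 7 - 3 * (2 * sinh r ^+ 2 + 1) = 2 * (c ^+ 2 - s ^+ 2).
    by rewrite c2 s2; ring.
  by field; rewrite d0 gt_eqF.
rewrite -atan_double; last first.
  rewrite (lt_le_trans (ltrN10 R)) ?divr_ge0 ?(ltW c0)//= ltr_pdivrMr// mul1r.
  by rewrite -(@ltr_pXn2r _ 2) ?nnegrE ?(ltW c0)// c2 s2; lra.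
congr (_%:E); rewrite hE.
move: (atan s) (atan _) (pi) (@pi_gt0 R) => x y p p0.
by field; rewrite gt_eqF.
Qed.

Lemma moduli_uniform_ball_large r : arsinh (1 / Num.sqrt 3) <= r ->
  moduli_uniform R [set b | moduli_dist b (i_star R) < r]
  = (1 - 6 / pi * atan (1 / Num.sqrt (2 * cosh (2 * r) - 3))
     - 3 / pi * cosh r
       * atan (4 * (cosh (2 * r)
                    + cosh r * Num.sqrt (2 * cosh (2 * r) - 3) - 1)
               / (5 * cosh (2 * r) - 2 * cosh (4 * r)
                  - 8 * sinh r ^+ 2 * cosh r
                    * Num.sqrt (2 * cosh (2 * r) - 3) + 1)))%:E.
Proof.
rewrite arsinh_le => r1.
have S0 : 0 < sinh r by apply: lt_le_trans r1; rewrite divr_gt0// sqrtr_gt0.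
have rge0 : 0 <= r by rewrite -sinh_mono sinh0 ltW.
have S3 : 1 / 3 <= sinh r ^+ 2.
  have -> : 1 / 3 = (1 / Num.sqrt 3) ^+ 2 :> R.
    by rewrite expr_div_n sqr_sqrtr// expr1n.
  by rewrite (sqr_le_norm _ (ltW S0)) ger0_norm// divr_ge0 ?sqrtr_ge0.
have S4 : (1 / 2) ^+ 2 < sinh r ^+ 2 by rewrite expr2; lra.
rewrite (moduli_uniform_ball rge0 (integral_disc_region_large (cosh_ge1 r)
  (sqr_cosh r) (measurable_disc_region rge0) S3)).
rewrite cap_primitive_half// -sqrt_double_cosh.
have s0 : 0 < Num.sqrt (2 * cosh (2 * r) - 3).
  by rewrite sqrtr_gt0 cosh_double; rewrite expr2 in S4; lra.
have s2 : Num.sqrt (2 * cosh (2 * r) - 3) ^+ 2 = 4 * sinh r ^+ 2 - 1.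
  by rewrite sqr_sqrtr cosh_double; [ring|rewrite expr2 in S4; lra].
rewrite cosh_quadruple; move: s0 s2; move: (Num.sqrt (2 * _ - 3)) => s s0 s2.
have := atan_large_radius (cosh_gt0 r) s0 S3 (sqr_cosh r) s2.
rewrite cosh_double; move: (cosh r) (sinh r ^+ 2) => c S2 aE.
have -> : 4 * (2 * S2 + 1 + c * s - 1) = 4 * (2 * S2 + c * s) by ring.
have -> : 5 * (2 * S2 + 1) - 2 * (2 * (2 * S2 + 1) ^+ 2 - 1) - 8 * S2 * c * s + 1
  = 4 - 6 * S2 - 16 * S2 ^+ 2 - 8 * S2 * (c * s) by ring.
rewrite aE; congr (_%:E).
move: (atan (1 / s)) (atan (c / s)) (atan _) (pi) (@pi_gt0 R) => x y z p p0.
by field; rewrite gt_eqF.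
Qed.

End distribution_function.

Theorem theorem4p4 (R : realType) (d : measure_display) (T : measurableType d)
    (P : probability T R) (tau : {RV P >-> moduli R})
    (tau_uniform : forall B : set (moduli R), measurable B ->
       distribution P tau B = moduli_uniform R B) :
  let F (r : R) := P [set t | moduli_dist (tau t) (i_star R) < r] in
  [/\ forall r : R, 0 <= r <= arsinh (1 / 2) ->
        F r = (6 * sinh (r / 2) ^+ 2)%:E,
      forall r : R, arsinh (1 / 2) <= r <= arsinh (1 / Num.sqrt 3) ->
        F r = (6 * sinh (r / 2) ^+ 2
               - 6 / pi * cosh r
                 * atan (4 * cosh r * Num.sqrt (2 * cosh (2 * r) - 3)
                         / (7 - 3 * cosh (2 * r)))
               + 12 / pi * atan (Num.sqrt (2 * cosh (2 * r) - 3)))%:E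
    & forall r : R, arsinh (1 / Num.sqrt 3) <= r ->
        F r = (1 - 6 / pi * atan (1 / Num.sqrt (2 * cosh (2 * r) - 3))
               - 3 / pi * cosh r
                 * atan (4 * (cosh (2 * r)
                              + cosh r * Num.sqrt (2 * cosh (2 * r) - 3) - 1)
                         / (5 * cosh (2 * r) - 2 * cosh (4 * r)
                            - 8 * sinh r ^+ 2 * cosh r
                              * Num.sqrt (2 * cosh (2 * r) - 3) + 1)))%:E].
Proof.
move=> F; have FE (r : R) : 0 <= r ->
    F r = moduli_uniform R [set b | moduli_dist b (i_star R) < r].
  by move=> r0; rewrite -tau_uniform//; exact: measurable_moduli_ball.
have a0 (x : R) : 0 <= x -> 0 <= arsinh x by exact: arsinh_ge0.
split=> r rE; rewrite FE.
- exact: moduli_uniform_ball_tiny.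
- by case/andP: rE.
- exact: moduli_uniform_ball_small.
- by case/andP: rE => + _; apply: le_trans; rewrite a0.
- exact: moduli_uniform_ball_large.
- by apply: le_trans rE; rewrite a0// divr_ge0 ?sqrtr_ge0.
Qed.
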